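(* Let $\mathcal{H}$ be a separable complex Hilbert space and let $A_1,\dots,A_n\in C_p$ for some $p>0$. (i) If $0<p<2$, then $$\sum_{i=1}^n\Big\|A_i-\frac1n\sum_{j=1}^n A_j\Big\|_p^p\ge n^{\frac p2-1}\sum_{i=1}^n\|A_i\|_p^p-n\Big\|\frac1n\sum_{j=1}^n A_j\Big\|_p^p .$$ (ii) If $2<p<\infty$, then $$n^{\frac p2-1}\sum_{i=1}^n\|A_i\|_p^p-n\Big\|\frac1n\sum_{j=1}^n A_j\Big\|_p^p\ge\sum_{i=1}^n\Big\|A_i-\frac1n\sum_{j=1}^n A_j\Big\|_p^p .$$
   Context: For a compact operator $A$ on $\mathcal{H}$ and $0<p<\infty$, $\|A\|_p=(\mathrm{tr}\,|A|^p)^{1/p}$, where $|A|=(A^*A)^{1/2}$ and $\mathrm{tr}$ is the usual trace (a norm for $p\ge1$, a quasi-norm for $0<p<1$). The Schatten $p$-class $C_p$ is the two-sided ideal of bounded operators on $\mathcal{H}$ consisting of the compact operators $A$ with $\|A\|_p<\infty$. *)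

(* Defs.v *)
From mathcomp Require Import all_boot all_order all_algebra.
From mathcomp Require Import all_classical all_reals all_analysis.
From mathcomp Require Export complex.

Set Implicit Arguments.
Unset Strict Implicit.
Unset Printing Implicit Defensive.

Import Order.TTheory GRing.Theory Num.Theory Num.Def.
Import numFieldNormedType.Exports.

Local Open Scope classical_set_scope.
Local Open Scope ring_scope.
Local Open Scope complex_scope.

Definition separable (T : topologicalType) : Prop :=
  exists2 D : set T, countable D & dense D.

(* The inner product is linear in its first argument and conjugate-linear in
   its second one. That it induces the norm of [H] is not part of its type:
   this is the hypothesis [hilbert_norm dot]. *)
Section Operators.
Context (R : realType) (H : completeNormedModType R[i]) (dot : {dot H for conjC}).
Implicit Types (A B S T : H -> H) (p : R).

Definition hilbert_norm : Prop := forall x : H, dot x x = `|x| ^+ 2.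

Definition bounded_operator A : Prop := linear A /\ continuous A.

Definition compact_operator A : Prop :=
  bounded_operator A /\ precompact (A @` [set x | `|x| <= 1]).

(* On [R[i]], [0 <= z] means that [z] is real and nonnegative. *)
Definition positive_operator T : Prop :=
  bounded_operator T /\ forall x, 0 <= dot (T x) x.

Definition adjoint A : H -> H :=
  get [set B : H -> H | bounded_operator B /\
                        forall x y, dot (A x) y = dot x (B y)].

Definition abs_operator A : H -> H :=
  get [set T : H -> H | positive_operator T /\ T \o T = adjoint A \o A].

(* Functional calculus t |-> t^p for a positive compact T: the bounded operator
   acting as s^p on ker (T - s). It is unique because the eigenvectors of T
   (ker T included, with 0^p = 0 for p > 0) span a dense subspace. *)
Definition power_operator T p : H -> H :=
  get [set S : H -> H | bounded_operator S /\
         forall (s : R) (x : H), T x = s%:C *: x -> S x = (s `^ p)%:C *: x].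

Definition orthonormal_basis (E : set H) : Prop :=
  [/\ forall e, E e -> dot e e = 1,
      forall e f, E e -> E f -> e <> f -> dot e f = 0 &
      forall x, (forall e, E e -> dot x e = 0) -> x = 0].

(* The trace of a positive operator, in [0, +oo]; its value does not depend on
   the orthonormal basis, so one is chosen. *)
Definition trace S : \bar R :=
  \esum_(e in get orthonormal_basis) (complex.Re (dot (S e) e))%:E.

Definition schatten_norm p A : \bar R :=
  (trace (power_operator (abs_operator A) p) `^ p^-1)%E.

Definition schatten_class p : set (H -> H) :=
  [set A | compact_operator A /\ (schatten_norm p A < +oo)%E].

End Operators.

(* Main.v *)
Require Import Defs.
From mathcomp Require Import all_boot all_order all_algebra finmap.
From mathcomp Require Import all_classical all_reals all_analysis.
From mathcomp Require Import ring lra.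

Set Implicit Arguments.
Unset Strict Implicit.
Unset Printing Implicit Defensive.

Import Order.TTheory GRing.Theory Num.Theory Num.Def.
Import numFieldNormedType.Exports.

Local Open Scope classical_set_scope.
Local Open Scope ring_scope.
Local Open Scope complex_scope.

(** Put q := p / 2 and, for a compact operator A, Q_A(v) := |A v|^2, which is the
    quadratic form of A^*A.  If e_f is an orthonormal basis of eigenvectors of
    A^*A with eigenvalues m_f, then |A|^p has the eigenvalues m_f^q, and
    [schatten_diagonalizes] identifies |A|_p^p with the sum of the m_f^q.

    Everything follows from two comparisons.  Let B_1, ..., B_N be compact, let
    X be the sum of the B_k^*B_k, and let tr X^q be the sum of the q-th powers of
    the eigenvalues of X.  If q >= 1, then
      sum_k |B_k|_p^p <= tr X^q <= N^(q - 1) sum_k |B_k|_p^p,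
    and both inequalities are reversed if 0 < q <= 1.  The theorem combines them
    for two families having the same X: pointwise in v,
      sum_i |(A_i - M) v|^2 + n |M v|^2 = sum_i |A_i v|^2
    ([sum_sqnorm_deviation]), so that the 2 n operators A_i - M (i < n) and
    M, ..., M share their X with the n operators A_i.  The comparison with
    the sum is applied to the former, the one with the mean to the latter.

    Both comparisons are instances of one inequality for substochastic matrices
    ([majorization_ge1], [majorization_le1]): if mu_i = sum_j w_ij lambda_j, with
    w >= 0, row sums at most 1 and column sums k, then Jensen's inequality in each
    row, followed by an exchange of sums, gives sum_i mu_i^q <= k sum_j lambda_j^q
    for q >= 1, and the reverse inequality for q <= 1.
    - Let F be an eigenbasis of X (eigenvalues l_f) and G_i one of B_i^*B_i
      (eigenvalues m_ih).  The matrix |<f, h>|^2 / N expresses l_f in terms of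
      the N m_ih; this is the comparison with the mean.
    - The matrix m_ih |<h, f>|^2 / l_f expresses m_ih in terms of the l_f.  Its
      row sums are m_ih <h, X^-1 h>, at most 1 because m_ih h h^* is below X; its
      column sums are <X f, f> / l_f = 1.  This is the comparison with the sum.
    The eigenbases of positive compact operators come from Zorn's lemma and the
    maximum of the norm on a compact set ([spectral_basis]); adjoints and
    diagonal operators come from the Riesz-Fischer theorem. *)

(** * Sums of nonnegative families and Jensen's inequality *)

Section WeightedSums.
Context {R : realType}.

(** Bernoulli's inequality for exponents in (0, 1] is Young's inequality for the
    product of t^q and 1, with the conjugate exponents 1/q and 1/(1 - q). *)
Lemma bernoulli_le1 (q t : R) : (0 < q)%R -> (q <= 1)%R -> (0 <= t)%R ->
  (t `^ q <= q * t + (1 - q))%R.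
Proof.
move=> q0; rewrite le_eqVlt => /predU1P[->|q1] t0.
  by rewrite powRr1// mul1r subrr addr0.
have := @conjugate_powR R (t `^ q) 1 q^-1 (1 - q)^-1.
rewrite powR_ge0 ler01 !invr_gt0 subr_gt0 !invrK powR1 -powRrM mulfV ?gt_eqF//.
rewrite powRr1// mulr1 mul1r addrCA subrr addr0 [(q * t)%R]mulrC.
by apply.
Qed.

(** The case of the exponent 1/q <= 1, at the point t^q. *)
Lemma bernoulli_ge1 (q t : R) : (1 <= q)%R -> (0 <= t)%R ->
  (q * t + (1 - q) <= t `^ q)%R.
Proof.
move=> q1 t0; have q0 : (0 < q)%R by rewrite (lt_le_trans ltr01).
have := @bernoulli_le1 q^-1 (t `^ q).
rewrite invr_gt0 invf_le1// powR_ge0 -powRrM mulfV ?gt_eqF// powRr1//.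
move=> /(_ q0 q1 isT); rewrite -(ler_pM2l q0) mulrDr mulVKf ?gt_eqF//.
rewrite mulrBr mulr1 mulfV ?gt_eqF//; lra.
Qed.

Local Open Scope ereal_scope.

Lemma esum_ge_term (T : choiceType) (S : set T) (a : T -> \bar R) t :
  (forall i, S i -> 0 <= a i) -> S t -> a t <= \esum_(i in S) a i.
Proof.
move=> a0 St; apply: esum_ge; exists [set t].
  by split; [exact: finite_set1|move=> _ ->].
by rewrite fsbig_set1.
Qed.

Lemma esumZl (T : choiceType) (S : set T) (c : R) (a : T -> \bar R) :
  (0 <= c)%R -> (forall i, S i -> 0 <= a i) ->
  \esum_(i in S) (c%:E * a i) = c%:E * \esum_(i in S) a i.
Proof.
have le (k : R) (b : T -> \bar R) : (0 <= k)%R -> (forall i, S i -> 0 <= b i) ->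
    \esum_(i in S) (k%:E * b i) <= k%:E * \esum_(i in S) b i.
  move=> k0 b0; apply: ge_ereal_sup => _ [X [finX XS] <-].
  apply: (le_trans _ (lee_wpmul2l _ (esum_ge (ex_intro2 _ _ X _ (lexx _))))) => //.
  rewrite !fsbig_finite//= big_seq_cond [in leRHS]big_seq_cond.
  rewrite ge0_sume_distrr// => i; rewrite andbT in_fset_set// => /set_mem Xi.
  exact/b0/XS.
move=> c0 a0; apply/eqP; rewrite eq_le le//=.
have [->|c1] := eqVneq c 0%R.
  by rewrite mul0e esum_ge0// => i Si; rewrite mul0e.
have cgt0 : (0 < c)%R by rewrite lt_def c1.
rewrite -lee_pdivlMl//.
have := le c^-1%R (fun i => c%:E * a i).
rewrite invr_ge0 => /(_ c0) h; apply: le_trans (h _).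
  by apply: le_esum => i _; rewrite muleA -EFinM mulVf// mul1e.
by move=> i Si; rewrite mule_ge0// ?a0// lee_fin.
Qed.

Lemma esum_exchange (T U : choiceType) (S : set T) (V : set U)
    (a : T -> U -> \bar R) : (forall i j, S i -> V j -> 0 <= a i j) ->
  \esum_(i in S) \esum_(j in V) a i j = \esum_(j in V) \esum_(i in S) a i j.
Proof.
move=> a0; rewrite !esum_esum//; last by move=> *; exact: a0.
apply: (@reindex_esum R _ _ _ _ (fun k : U * T => (k.2, k.1))); split.
- by move=> [i j] [].
- by move=> [i j] [k l] _ _ /= [-> ->].
- by move=> [i j] [Si Vj]; exists (j, i).
Qed.

Section Jensen.
Variables (T : choiceType) (S : set T) (w l : T -> R) (m : R).
Hypotheses (w0 : forall i, S i -> (0 <= w i)%R).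
Hypotheses (l0 : forall i, S i -> (0 <= l i)%R) (m0 : (0 <= m)%R).
Hypothesis mE : \esum_(i in S) (w i * l i)%:E = m%:E.
Hypothesis w_le1 : \esum_(i in S) (w i)%:E <= 1.

Let ew0 i : S i -> 0 <= (w i)%:E. Proof. by move=> Si; rewrite lee_fin w0. Qed.
Let ewl0 i : S i -> 0 <= (w i * l i)%:E.
Proof. by move=> Si; rewrite lee_fin mulr_ge0 ?w0 ?l0. Qed.

(** The weights need not add up to 1: the convex function t^q vanishes at 0, so
    missing mass can be put there.  The proof sums the tangent line of t^q at m,
    which is Bernoulli's inequality at l_i / m. *)
Lemma jensen_esum_ge1 (q : R) : (1 <= q)%R ->
  (m `^ q)%:E <= \esum_(i in S) (w i * l i `^ q)%:E.
Proof.
move=> q1; have q0 : (0 < q)%R by rewrite (lt_le_trans ltr01).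
have [->|mn0] := eqVneq m 0%R.
  rewrite powR0 ?gt_eqF//; apply: esum_ge0 => i Si.
  by rewrite lee_fin mulr_ge0 ?powR_ge0 ?w0.
have mgt0 : (0 < m)%R by rewrite lt_def mn0.
have h : \esum_(i in S) ((m `^ q * q / m)%:E * (w i * l i)%:E) <=
    \esum_(i in S) ((w i * l i `^ q)%:E + ((q - 1) * m `^ q)%:E * (w i)%:E).
  apply: le_esum => i Si; rewrite -!EFinM -EFinD lee_fin.
  have := @bernoulli_ge1 q (l i / m) q1.
  rewrite divr_ge0 ?l0// => /(_ isT).
  move=> /(ler_wpM2l (powR_ge0 m q)); rewrite -powRM ?divr_ge0 ?l0//.
  rewrite (mulrCA m) mulfV// mulr1 => /(ler_wpM2l (w0 Si)).
  move=> h; rewrite -subr_ge0; move: h; rewrite -subr_ge0.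
  by congr (is_true (0 <= _)%R); ring.
move: h; rewrite esumZl ?mE; [|
  by rewrite !mulr_ge0 ?powR_ge0 ?invr_ge0// ltW|exact: ewl0].
rewrite esumD; last first.
- by move=> i Si; rewrite mule_ge0 ?ew0// lee_fin mulr_ge0 ?powR_ge0// subr_ge0.
- by move=> i Si; rewrite lee_fin mulr_ge0 ?powR_ge0 ?w0.
rewrite esumZl ?mulr_ge0 ?powR_ge0 ?subr_ge0// -EFinM divfK// => h.
have {}h : (m `^ q * q)%:E <= \esum_(i in S) (w i * l i `^ q)%:E
   + ((q - 1) * m `^ q)%:E.
  apply: (le_trans h); rewrite leeD2l// -[leRHS]mule1 lee_wpmul2l//.
  by rewrite lee_fin mulr_ge0 ?powR_ge0 ?subr_ge0.
rewrite -leeBlDr// -EFinB in h.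
by apply: le_trans h; rewrite lee_fin; lra.
Qed.

Lemma jensen_esum_le1 (q : R) : (0 < q)%R -> (q <= 1)%R ->
  \esum_(i in S) (w i * l i `^ q)%:E <= (m `^ q)%:E.
Proof.
move=> q0 q1.
have [mz|mn0] := eqVneq m 0%R.
  rewrite mz powR0 ?gt_eqF// esum1// => i Si.
  have : (w i * l i)%:E <= m%:E by rewrite -mE; exact: esum_ge_term.
  rewrite mz lee_fin => wl; have : (w i * l i == 0)%R.
    by rewrite eq_le wl mulr_ge0 ?w0 ?l0.
  rewrite mulf_eq0 => /orP[/eqP->|/eqP->]; first by rewrite mul0r.
  by rewrite powR0 ?gt_eqF// mulr0.
have mgt0 : (0 < m)%R by rewrite lt_def mn0.
have h : \esum_(i in S) (w i * l i `^ q)%:E <=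
    \esum_(i in S) ((m `^ q * q / m)%:E * (w i * l i)%:E
      + ((1 - q) * m `^ q)%:E * (w i)%:E).
  apply: le_esum => i Si; rewrite -!EFinM -EFinD lee_fin.
  have := @bernoulli_le1 q (l i / m) q0 q1.
  rewrite divr_ge0 ?l0// => /(_ isT).
  move=> /(ler_wpM2l (powR_ge0 m q)); rewrite -powRM ?divr_ge0 ?l0//.
  rewrite (mulrCA m) mulfV// mulr1 => /(ler_wpM2l (w0 Si)).
  move=> h; rewrite -subr_ge0; move: h; rewrite -subr_ge0.
  by congr (is_true (0 <= _)%R); ring.
apply: (le_trans h).
have c0 : (0 <= m `^ q * q / m)%R by rewrite !mulr_ge0 ?powR_ge0 ?invr_ge0// ltW.
have d0 : (0 <= (1 - q) * m `^ q)%R by rewrite mulr_ge0 ?powR_ge0// subr_ge0.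
rewrite esumD; [|by move=> i Si; rewrite mule_ge0 ?ewl0|by move=> i Si; rewrite mule_ge0 ?ew0].
rewrite !esumZl// mE -EFinM divfK//.
apply: (@le_trans _ _ ((m `^ q * q)%:E + ((1 - q) * m `^ q)%:E)).
  by rewrite leeD2l// -[leRHS]mule1 lee_wpmul2l.
by rewrite -EFinD lee_fin; lra.
Qed.

End Jensen.

(** Jensen's inequality in each row, followed by an exchange of sums.  The column
    sums are prescribed only where l does not vanish: elsewhere w i j * l j and
    w i j * l j ^ q are zero. *)
Section Majorization.
Variables (T U : choiceType) (S : set T) (V : set U).
Variables (w : T -> U -> R) (m : T -> R) (l : U -> R) (k : R).
Hypotheses (w0 : forall i j, S i -> V j -> (0 <= w i j)%R) (k0 : (0 <= k)%R).
Hypotheses (m0 : forall i, S i -> (0 <= m i)%R).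
Hypotheses (l0 : forall j, V j -> (0 <= l j)%R).
Hypothesis mE : forall i, S i -> \esum_(j in V) (w i j * l j)%:E = (m i)%:E.
Hypothesis row : forall i, S i -> \esum_(j in V) (w i j)%:E <= 1.
Hypothesis col : forall j, V j -> l j != 0%R ->
  \esum_(i in S) (w i j)%:E = k%:E.

Let total (q : R) : (0 < q)%R ->
  \esum_(i in S) \esum_(j in V) (w i j * l j `^ q)%:E =
  k%:E * \esum_(j in V) (l j `^ q)%:E.
Proof.
move=> q0; rewrite esum_exchange; last first.
  by move=> i j Si Vj; rewrite lee_fin mulr_ge0 ?w0 ?powR_ge0.
rewrite -esumZl//; last by move=> j Vj; rewrite lee_fin powR_ge0.
apply: eq_esum => j Vj.
have [->|lj] := eqVneq (l j) 0%R.
  by rewrite powR0 ?gt_eqF// mule0 esum1// => i _; rewrite mulr0.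
rewrite -(col Vj lj) muleC -esumZl ?powR_ge0//; last first.
  by move=> i Si; rewrite lee_fin w0.
by apply: eq_esum => i Si; rewrite mulrC EFinM.
Qed.

Lemma majorization_ge1 (q : R) : (1 <= q)%R ->
  \esum_(i in S) (m i `^ q)%:E <= k%:E * \esum_(j in V) (l j `^ q)%:E.
Proof.
move=> q1; rewrite -total ?(lt_le_trans ltr01)//.
apply: le_esum => i Si.
by apply: jensen_esum_ge1 => //; [move=> j; exact: w0|exact: m0|exact: mE|exact: row].
Qed.

Lemma majorization_le1 (q : R) : (0 < q)%R -> (q <= 1)%R ->
  (k%:E * (\esum_(j in V) (l j `^ q)%:E) <= \esum_(i in S) (m i `^ q)%:E)%E.
Proof.
move=> q0 q1; rewrite -total//.
apply: le_esum => i Si.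
by apply: jensen_esum_le1 => //; [move=> j; exact: w0|exact: m0|exact: mE|exact: row].
Qed.

End Majorization.

End WeightedSums.

(** Sums over arbitrary sets, as suprema of sums over finite sets of indices. *)
Section EsumFset.
Context {R : realType} {T : choiceType}.
Variables (S : set T) (a : T -> R).
Hypothesis a0 : forall i, S i -> 0 <= a i.

Lemma esum_ge_fset (A : {fset T}) : [set` A] `<=` S ->
  ((\sum_(i <- A) a i)%:E <= \esum_(i in S) (a i)%:E)%E.
Proof.
move=> AS; apply: esum_ge; exists [set` A]; first by split.
by rewrite fsbig_finite//= set_fsetK sumEFin.
Qed.

Lemma esum_le_fset (s : R) :
  (forall A : {fset T}, [set` A] `<=` S -> \sum_(i <- A) a i <= s) ->
  (\esum_(i in S) (a i)%:E <= s%:E)%E.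
Proof.
move=> h; apply: ge_ereal_sup => _ [X [finX XS] <-].
rewrite fsbig_finite//= sumEFin lee_fin; apply: h.
by rewrite fset_setK.
Qed.

Lemma esum_approx (s e : R) : \esum_(i in S) (a i)%:E = s%:E -> 0 < e ->
  exists2 A : {fset T}, [set` A] `<=` S & s - e < \sum_(i <- A) a i.
Proof.
move=> sE e0; apply: contrapT => h.
have : (s%:E <= (s - e)%:E)%E.
  rewrite -sE; apply: esum_le_fset => A AS; rewrite leNgt; apply/negP => lt.
  by apply: h; exists A.
by rewrite lee_fin; lra.
Qed.

End EsumFset.

Section EsumFinite.
Context {R : realType}.
Local Open Scope ereal_scope.

Lemma esum_finType (I : finType) (a : I -> \bar R) : (forall i, 0 <= a i) ->
  \esum_(i in [set: I]) a i = \sum_i a i.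
Proof.
move=> a0; rewrite esum_fset//; last exact: finite_finset.
rewrite (fsbigE (index_enum I)) ?index_enum_uniq//.
  by apply: eq_bigl => i; rewrite in_setT.
by move=> i _; rewrite mem_index_enum.
Qed.

Lemma esum_sigma (I : finType) (U : choiceType) (F : I -> set U)
    (a : I -> U -> \bar R) : (forall i j, F i j -> 0 <= a i j) ->
  \esum_(k in [set: I] `*`` F) a k.1 k.2 = \sum_i \esum_(j in F i) a i j.
Proof.
move=> a0; rewrite -esum_esum; last by move=> i j _; exact: a0.
by rewrite esum_finType// => i; apply: esum_ge0 => j; exact: a0.
Qed.

Lemma esum_support (U : choiceType) (F : set U) (a : U -> R) (B : {fset U}) :
  (forall f, F f -> 0 <= a f)%R -> [set` B] `<=` F ->
  (forall f, F f -> f \notin B -> a f = 0%R) ->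
  \esum_(f in F) (a f)%:E = (\sum_(f <- B) a f)%R%:E.
Proof.
move=> a0 BF az; apply/eqP; rewrite eq_le esum_ge_fset// andbT.
apply: esum_le_fset => A AF.
rewrite (big_fsetID _ (mem B))/= [X in (_ + X)%R]big_seq_cond.
rewrite [X in (_ + X)%R]big1 ?addr0; last first.
  move=> f; rewrite !inE/= => /andP[/andP[fA fB] _]; apply: az => //.
  exact: AF.
rewrite (big_fsetID _ (mem A) B)/=.
have -> : [fset x in A | mem B x]%fset = [fset x in B | mem A x]%fset.
  by apply/fsetP => f; rewrite !inE/= andbC.
rewrite lerDl big_seq sumr_ge0// => f; rewrite !inE/= => /andP[fB _].
by apply: a0; exact: BF.
Qed.

End EsumFinite.

(** * Inner product spaces *)

Section ComplexModulus.
Context {R : realType}.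
Implicit Types z : R[i].

(** The squared modulus as an element of R; the norm of R[i] has values in R[i]. *)
Definition sqmod z : R := complex.Re z ^+ 2 + complex.Im z ^+ 2.

Lemma sqmodE z : (sqmod z)%:C = `|z| ^+ 2.
Proof. by rewrite /sqmod add_Re2_Im2. Qed.

Lemma sqmod_ge0 z : 0 <= sqmod z.
Proof. by rewrite addr_ge0 ?sqr_ge0. Qed.

Lemma sqmod0 : sqmod 0 = 0.
Proof. by rewrite /sqmod /= expr0n /= addr0. Qed.

Lemma sqmod_eq0 z : sqmod z = 0 -> z = 0.
Proof.
move=> h; have : `|z| ^+ 2 = 0 by rewrite -sqmodE h.
by move/eqP; rewrite sqrf_eq0 normr_eq0 => /eqP.
Qed.

Lemma sqmodM : {morph sqmod : z w / z * w}.
Proof.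
by move=> z w; apply: complexI; rewrite rmorphM/= !sqmodE normrM exprMn.
Qed.

Lemma sqmod_real (x : R) : sqmod x%:C = x ^+ 2.
Proof. by rewrite /sqmod /= expr0n /= addr0. Qed.

Lemma sqmodJ z : sqmod z^*%C = sqmod z.
Proof. by case: z => a b; rewrite /sqmod /= sqrrN. Qed.

Lemma mulJc z : z * z^*%C = (sqmod z)%:C.
Proof. by case: z => a b; rewrite /sqmod; simpc; congr (_ +i* _); ring. Qed.

Lemma Re_sqr_le z : complex.Re z ^+ 2 <= sqmod z.
Proof. by rewrite lerDl sqr_ge0. Qed.

Lemma Re_realM (x : R) z : complex.Re (x%:C * z) = x * complex.Re z.
Proof. by case: z => a b /=; rewrite mul0r subr0. Qed.

Lemma ReD z w : complex.Re (z + w) = complex.Re z + complex.Re w.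
Proof. by case: z; case: w. Qed.

Lemma ReN z : complex.Re (- z) = - complex.Re z.
Proof. by case: z. Qed.

Lemma ReJ z : complex.Re (z^*%C) = complex.Re z.
Proof. by case: z. Qed.

Lemma conjcM z w : (z * w)^*%C = z^*%C * w^*%C.
Proof. exact: rmorphM. Qed.

Lemma sqmodD_le z w :
  sqmod (z + w) <= 2 * (sqmod z + sqmod w).
Proof.
case: z => a b; case: w => c d; rewrite /sqmod /=.
have := sqr_ge0 (a - c); have := sqr_ge0 (b - d); nra.
Qed.

End ComplexModulus.

(** [bounded_operator] provides linearity as a proposition about a bare function,
    whence these forms of the usual identities. *)
Section LinearMaps.
Context {K : nzRingType} {V W : lmodType K} (A : V -> W).
Hypothesis linA : linear A.

Lemma lin0 : A 0 = 0.
Proof. by have := linA (-1) 0 0; rewrite !scaleN1r !addNr. Qed.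
Lemma linZ a x : A (a *: x) = a *: A x.
Proof. by have := linA a x 0; rewrite lin0 !addr0. Qed.
Lemma linD x y : A (x + y) = A x + A y.
Proof. by have := linA 1 x y; rewrite !scale1r. Qed.
Lemma linB x y : A (x - y) = A x - A y.
Proof. by rewrite linD -[- y]scaleN1r linZ scaleN1r. Qed.
Lemma lin_sum I (r : seq I) (u : I -> V) :
  A (\sum_(i <- r) u i) = \sum_(i <- r) A (u i).
Proof.
elim: r => [|i r IH]; first by rewrite !big_nil lin0.
by rewrite !big_cons linD IH.
Qed.

End LinearMaps.

Section HilbertSpace.
Context {R : realType} {H : completeNormedModType R[i]}.
Variable dot : {dot H for conjC}.
Implicit Types x y z v : H.

Lemma dotDl x y z : dot (x + y) z = dot x z + dot y z.
Proof. by rewrite linearDl. Qed.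
Lemma dotDr x y z : dot x (y + z) = dot x y + dot x z.
Proof. by rewrite linearDr. Qed.
Lemma dotZl (a : R[i]) x y : dot (a *: x) y = a * dot x y.
Proof. by rewrite linearZl_LR. Qed.
Lemma dotZr (a : R[i]) x y : dot x (a *: y) = a^*%C * dot x y.
Proof. by rewrite linearZr_LR. Qed.
Lemma dotNl x y : dot (- x) y = - dot x y.
Proof. by rewrite linearNl. Qed.
Lemma dotNr x y : dot x (- y) = - dot x y.
Proof. by rewrite linearNr. Qed.
Lemma dotBl x y z : dot (x - y) z = dot x z - dot y z.
Proof. by rewrite dotDl dotNl. Qed.
Lemma dot0l y : dot 0 y = 0.
Proof. by rewrite linear0l. Qed.
Lemma dot0r x : dot x 0 = 0.
Proof. by rewrite linear0r. Qed.
Lemma dotC x y : dot x y = (dot y x)^*%C.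
Proof. by rewrite hermC expr0 mul1r. Qed.
Lemma dot_suml I (r : seq I) (u : I -> H) y :
  dot (\sum_(i <- r) u i) y = \sum_(i <- r) dot (u i) y.
Proof.
elim: r => [|i r IH]; first by rewrite !big_nil dot0l.
by rewrite !big_cons dotDl IH.
Qed.

(** The squared norm as an element of R.  Squares avoid both the R[i]-valued norm
    and square roots; balls and operator bounds are expressed with them. *)
Definition sqnorm x : R := complex.Re (dot x x).

Lemma dot_sqnorm x : dot x x = (sqnorm x)%:C.
Proof.
have : 0 <= dot x x by exact: dnorm_ge0.
by rewrite lecE /sqnorm => /andP[/eqP]; case: (dot x x) => a b /= ->.
Qed.

Lemma sqnorm_ge0 x : 0 <= sqnorm x.
Proof. by rewrite -ler0c -dot_sqnorm; exact: dnorm_ge0. Qed.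

Lemma sqnorm0 : sqnorm 0 = 0.
Proof. by rewrite /sqnorm dot0l. Qed.

Lemma sqnorm_eq0 x : sqnorm x = 0 -> x = 0.
Proof.
move=> h; have := dot_sqnorm x; rewrite h => /eqP.
by rewrite dnorm_eq0 => /eqP.
Qed.

Lemma sqnorm_gt0 x : x != 0 -> 0 < sqnorm x.
Proof.
by move=> x0; rewrite lt_def sqnorm_ge0 andbT; apply: contra_neq x0 => /sqnorm_eq0.
Qed.

Lemma sqnormD x y : sqnorm (x + y) = sqnorm x + sqnorm y + 2 * complex.Re (dot x y).
Proof.
rewrite /sqnorm dotDl !dotDr (dotC y x) !ReD ReJ; ring.
Qed.

Lemma sqnormZ (a : R[i]) x : sqnorm (a *: x) = sqmod a * sqnorm x.
Proof. by rewrite /sqnorm dotZl dotZr mulrA mulJc Re_realM. Qed.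

Lemma sqnormN x : sqnorm (- x) = sqnorm x.
Proof. by rewrite /sqnorm dotNl dotNr opprK. Qed.

Lemma sqnormB x y : sqnorm (x - y) = sqnorm x + sqnorm y - 2 * complex.Re (dot x y).
Proof. by rewrite sqnormD sqnormN dotNr ReN mulrN. Qed.

(** The squared norm of |y|^2 x - <x, y> y is nonnegative. *)
Lemma cauchy_schwarz x y : sqmod (dot x y) <= sqnorm x * sqnorm y.
Proof.
have [->|y0] := eqVneq y 0.
  by rewrite dot0r sqmod0 mulr_ge0 ?sqnorm_ge0.
have hy := sqnorm_gt0 y0.
have := sqnorm_ge0 (((sqnorm y)%:C : R[i]) *: x - dot x y *: y).
rewrite sqnormB !sqnormZ dotZl dotZr [_^*%C * _]mulrC mulJc sqmod_real.
rewrite -rmorphM/= => h.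
have : 0 <= sqnorm y * (sqnorm x * sqnorm y - sqmod (dot x y)).
  by move: h; congr (is_true (0 <= _)); ring.
by rewrite pmulr_rge0// subr_ge0.
Qed.

Lemma dot_ext x y : (forall z, dot x z = dot y z) -> x = y.
Proof.
move=> h; apply/eqP; rewrite -subr_eq0; apply/eqP/sqnorm_eq0.
by rewrite /sqnorm {1}dotBl h subrr.
Qed.

Hypothesis dot_norm : hilbert_norm dot.

Lemma norm_sqnorm x : `|x| ^+ 2 = (sqnorm x)%:C.
Proof. by rewrite -dot_norm dot_sqnorm. Qed.

Lemma norm_lt_sqnorm x (e : R) : 0 < e -> (`|x| < e%:C) = (sqnorm x < e ^+ 2).
Proof.
move=> e0; rewrite -(@ltr_pXn2r _ 2%N)// ?nnegrE ?ler0c ?(ltW e0)//.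
by rewrite norm_sqnorm -rmorphXn ltcR.
Qed.

Lemma nbhs_sqnorm x (U : set H) :
  nbhs x U <-> exists2 e : R, 0 < e & forall y, sqnorm (x - y) < e -> U y.
Proof.
rewrite -nbhs_nbhs_norm; split.
  case=> /= d; rewrite ltcE => /= /andP[/eqP di d0] dU.
  exists (complex.Re d ^+ 2); first by rewrite exprn_gt0.
  move=> y; rewrite -norm_lt_sqnorm// => xy; apply: dU; rewrite /ball_/=.
  by case: d di d0 xy => a b /= -> _.
case=> e e0 eU; exists (Num.sqrt e)%:C => /=; first by rewrite ltcR sqrtr_gt0.
move=> y /=; rewrite norm_lt_sqnorm ?sqrtr_gt0// sqr_sqrtr ?(ltW e0)//.
exact: eU.
Qed.

Lemma bounded_operatorP (A : H -> H) : bounded_operator A <->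
  linear A /\ exists2 C : R, 0 <= C & forall x, sqnorm (A x) <= C * sqnorm x.
Proof.
split; move=> [linA].
  have AZ := linZ linA; have A0 := lin0 linA.
  move=> cA; split=> //.
  have /(cA 0)/nbhs_sqnorm[d d0 Hd] : nbhs (A 0) [set y | sqnorm y < 1].
    by apply/nbhs_sqnorm; exists 1 => // y; rewrite A0 sub0r sqnormN.
  exists (2 / d); first by rewrite divr_ge0// ltW.
  move=> x; have [->|x0] := eqVneq x 0; first by rewrite A0 sqnorm0 mulr0.
  have hx := sqnorm_gt0 x0.
  have := Hd ((Num.sqrt (d / 2 / sqnorm x))%:C *: x).
  rewrite /= AZ sub0r sqnormN !sqnormZ sqmod_real sqr_sqrtr; last first.
    by rewrite !divr_ge0 ?ltW.
  rewrite divfK ?gt_eqF// => h.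
  have {h} : d / 2 / sqnorm x * sqnorm (A x) < 1 by apply: h; lra.
  move=> /ltW; rewrite -(ler_pM2l (_ : 0 < 2 / d * sqnorm x)); last first.
    by rewrite mulr_gt0// divr_gt0.
  rewrite mulr1; apply: le_trans; rewrite le_eqVlt; apply/orP; left; apply/eqP.
  by field; rewrite !gt_eqF.
case=> C C0 bA; split=> // x U /nbhs_sqnorm[e e0 eU].
apply/nbhs_sqnorm; exists (e / (C + 1)); first by rewrite divr_gt0// ltr_wpDl.
move=> y h; apply: eU.
rewrite -(linB linA).
apply: le_lt_trans (bA _) _.
move: h; rewrite ltr_pdivlMr ?ltr_wpDl//; apply: le_lt_trans.
by rewrite mulrC ler_wpM2l ?sqnorm_ge0// lerDl.
Qed.

(** * Orthonormal bases *)

Definition orthonormal_set (F : set H) : Prop :=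
  (forall e, F e -> dot e e = 1) /\
  (forall e f, F e -> F f -> e <> f -> dot e f = 0).

Section OrthonormalSets.
Variable F : set H.
Implicit Types (a : H -> R[i]) (A B : {fset H}).
Hypothesis ortF : orthonormal_set F.

Lemma dot_combo a A g : [set` A] `<=` F -> F g ->
  dot (\sum_(f <- A) a f *: f) g = if g \in A then a g else 0.
Proof.
move=> AF Fg; rewrite dot_suml.
have zero f : f \in A -> f != g -> dot (a f *: f) g = 0.
  by move=> fA fg; rewrite dotZl ortF.2 ?mulr0//; [exact: AF|exact/eqP].
case: ifPn => gA.
  rewrite (bigD1_seq g) ?fset_uniq//= dotZl ortF.1// mulr1 big_seq_cond big1 ?addr0//.
  by move=> f /andP[]; exact: zero.
rewrite big_seq big1// => f fA; apply: zero => //.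
by apply: contraNneq gA => <-.
Qed.

Lemma dot_comboE a A y :
  dot y (\sum_(f <- A) a f *: f) = \sum_(f <- A) (a f)^*%C * dot y f.
Proof.
rewrite dotC dot_suml rmorph_sum; apply: eq_bigr => f _.
by rewrite dotZl rmorphM/= [in RHS]dotC.
Qed.

Lemma Re_sum I (r : seq I) (z : I -> R[i]) :
  complex.Re (\sum_(i <- r) z i) = \sum_(i <- r) complex.Re (z i).
Proof.
elim: r => [|i r IH]; first by rewrite !big_nil.
by rewrite !big_cons ReD IH.
Qed.

Lemma sqnorm_combo a A : [set` A] `<=` F ->
  sqnorm (\sum_(f <- A) a f *: f) = \sum_(f <- A) sqmod (a f).
Proof.
move=> AF; rewrite /sqnorm dot_comboE Re_sum big_seq [RHS]big_seq.
apply: eq_bigr => f fA; rewrite dot_combo//; last exact: AF.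
by rewrite fA mulrC mulJc.
Qed.

Lemma sqnorm_residual x A : [set` A] `<=` F ->
  sqnorm (x - \sum_(f <- A) dot x f *: f) =
  sqnorm x - \sum_(f <- A) sqmod (dot x f).
Proof.
move=> AF; rewrite sqnormB sqnorm_combo// dot_comboE Re_sum.
have -> : \sum_(i <- A) complex.Re ((dot x i)^* * dot x i) =
          \sum_(f <- A) sqmod (dot x f).
  by apply: eq_bigr => f _; rewrite mulrC mulJc.
by ring.
Qed.

Lemma bessel x : (\esum_(f in F) (sqmod (dot x f))%:E <= (sqnorm x)%:E)%E.
Proof.
apply: esum_le_fset => A AF.
by have := sqnorm_ge0 (x - \sum_(f <- A) dot x f *: f); rewrite sqnorm_residual// subr_ge0.
Qed.

(** Coefficients pass to limits of vectors. *)
Lemma dot_eq_closure (l : H) f (z : R[i]) : F f ->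
  (forall e, 0 < e -> exists2 v, sqnorm (l - v) < e & dot v f = z) -> dot l f = z.
Proof.
move=> Ff h; apply/eqP; rewrite -subr_eq0; apply/eqP/sqmod_eq0/eqP.
rewrite eq_le sqmod_ge0 andbT leNgt; apply/negP => d0.
have [v hv vz] := h _ d0; move: hv; apply/negP; rewrite -leNgt -vz -dotBl.
have := cauchy_schwarz (l - v) f.
have -> : sqnorm f = 1 by rewrite /sqnorm ortF.1.
by rewrite mulr1.
Qed.

(** Convergence of sums over F, which may be uncountable, is convergence along the
    filter of the finite subsets that contain a given one. *)
Let large : set_system {fset H} :=
  filter_from [set A : {fset H} | [set` A] `<=` F]
    (fun A => [set B : {fset H} | (A `<=` B)%fset /\ [set` B] `<=` F]).

Local Instance large_filter : ProperFilter large.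
Proof.
apply: filter_from_proper; last by move=> A AF; exists A; split.
apply: filter_from_filter; first by exists fset0 => f /=; rewrite inE.
move=> A B AF BF; exists (A `|` B)%fset.
  by move=> f /=; rewrite in_fsetU => /orP[/AF|/BF].
by move=> C [/fsubUsetP[AC BC] CF].
Qed.

(** The finite partial sums are Cauchy, because the square of the distance between
    two nested ones is at most the tail of the sum of the |a f|^2.  The second
    conclusion says that the series converges to x. *)
Lemma riesz_fischer a : (\esum_(f in F) (sqmod (a f))%:E < +oo)%E ->
  exists x, (forall f, F f -> dot x f = a f) /\
    forall e, 0 < e -> exists2 A : {fset H}, [set` A] `<=` F &
      sqnorm (x - \sum_(f <- A) a f *: f) < e.
Proof.
move=> fin; pose v A : H := \sum_(f <- A) a f *: f.
have a0 f : F f -> 0 <= sqmod (a f) by rewrite sqmod_ge0.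
have [s sE] : exists s, \esum_(f in F) (sqmod (a f))%:E = s%:E.
  exists (fine (\esum_(f in F) (sqmod (a f))%:E)); rewrite fineK//.
  by rewrite ge0_fin_numE// esum_ge0// => f Ff; rewrite lee_fin a0.
have tail A B : [set` A] `<=` F -> [set` B] `<=` F -> (A `<=` B)%fset ->
    sqnorm (v A - v B) <= s - \sum_(f <- A) sqmod (a f).
  move=> AF BF AB.
  have splitB (V : zmodType) (u : H -> V) :
      \sum_(f <- B) u f = \sum_(f <- A) u f + \sum_(f <- (B `\` A)%fset) u f.
    rewrite (big_fsetID _ (mem A)) /=; congr (_ + _).
      by apply: eq_fbigl => f; rewrite !inE/= andbC; apply/andb_idr/fsubsetP.
    by apply: eq_fbigl => f; rewrite !inE/= andbC.
  have DF : [set` (B `\` A)%fset] `<=` F.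
    by move=> f /=; rewrite in_fsetD => /andP[_ /BF].
  rewrite /v (splitB _ (fun f => a f *: f)) opprD addrA subrr sub0r sqnormN.
  rewrite sqnorm_combo// lerBrDl -splitB -lee_fin -sE.
  exact: esum_ge_fset.
have cauchyv : cauchy (v @ large).
  apply: cauchy_exP => eps; rewrite ltcE/= => /andP[/eqP ei e0].
  have [A AF sA] := esum_approx sE (exprn_gt0 2 e0).
  exists (v A); exists A => // B [AB BF] /=.
  rewrite -ball_normE /ball_/=.
  have -> : eps = (complex.Re eps)%:C by case: eps ei {e0 sA} => x y /= ->.
  rewrite norm_lt_sqnorm//; apply: le_lt_trans (tail _ _ AF BF AB) _.
  lra.
have /cauchy_cvgP/cvg_ex[/= x vx] := cauchyv.
have close e A0 : 0 < e -> [set` A0] `<=` F -> exists2 A,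
    [set` A] `<=` F /\ (A0 `<=` A)%fset & sqnorm (x - v A) < e.
  move=> e0 A0F; have /vx[A AF Ae] : nbhs x [set y | sqnorm (x - y) < e].
    by apply/nbhs_sqnorm; exists e.
  have AA0F : [set` (A `|` A0)%fset] `<=` F.
    by move=> f /=; rewrite in_fsetU => /orP[/AF|/A0F].
  exists (A `|` A0)%fset; first by split => //; exact: fsubsetUr.
  by apply: Ae; split => //; exact: fsubsetUl.
exists x; split=> [f Ff|e e0].
  apply: dot_eq_closure => // e e0.
  have fF : [set` [fset f]%fset] `<=` F by move=> g /=; rewrite inE => /eqP->.
  have [A [AF fA] xA] := close e [fset f]%fset e0 fF.
  exists (v A) => //; rewrite dot_combo//.
  by move: fA; rewrite fsub1set => ->.
have set0F : [set` (fset0 : {fset H})] `<=` F by move=> f /=; rewrite inE.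
by have [A [AF _] xA] := close e fset0 e0 set0F; exists A.
Qed.

End OrthonormalSets.

Section Bases.
Variable F : set H.
Hypothesis basF : orthonormal_basis dot F.

Lemma basis_orthonormal : orthonormal_set F.
Proof. by case: basF. Qed.
Let ortF := basis_orthonormal.

Lemma basis_ext x y : (forall f, F f -> dot x f = dot y f) -> x = y.
Proof.
move=> xy; apply/eqP; rewrite -subr_eq0; apply/eqP.
by case: basF => _ _; apply => f Ff; rewrite dotBl xy ?subrr.
Qed.

Lemma coef_lty x : (\esum_(f in F) (sqmod (dot x f))%:E < +oo)%E.
Proof. exact: le_lt_trans (bessel ortF x) (ltry _). Qed.

(** The series of the coefficients of x converges to some y; as F is a basis and
    y has the coefficients of x, it is x. *)
Lemma basis_dense x (e : R) : 0 < e -> exists2 A : {fset H}, [set` A] `<=` F &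
  sqnorm (x - \sum_(f <- A) dot x f *: f) < e.
Proof.
have [y [yx dy]] := riesz_fischer ortF (coef_lty x).
have <- : y = x by apply: basis_ext => f Ff; rewrite yx.
by move=> e0; have [A AF yA] := dy e e0; exists A => //;
  rewrite big_seq (eq_bigr (fun f => dot x f *: f)) -?big_seq// => f /AF /yx->.
Qed.

Lemma parseval x : \esum_(f in F) (sqmod (dot x f))%:E = (sqnorm x)%:E.
Proof.
apply/eqP; rewrite eq_le (bessel ortF)//=.
apply/lee_addgt0Pr => e e0; have [A AF] := basis_dense x e0.
rewrite (sqnorm_residual ortF)// ltrBlDr => /ltW xA.
apply: (@le_trans _ _ ((\sum_(f <- A) sqmod (dot x f)) + e)%:E).
  by rewrite lee_fin addrC.
by rewrite EFinD leeD2r// esum_ge_fset// => f _; exact: sqmod_ge0.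
Qed.

End Bases.

(** * Adjoints and diagonal operators *)

Section FixedBasis.
Variable F : set H.
Hypothesis basF : orthonormal_basis dot F.
Let ortF := basis_orthonormal basF.

(** Riesz representation of the functional x |-> <A x, y>: its representative must
    have the coefficients conj <A f, y>.  Testing the functional on the finite
    combinations w of F with these coefficients gives |w|^4 <= C |w|^2 |y|^2, so
    the coefficients are square-summable; density of the combinations
    concludes. *)
Lemma adjoint_vector (A : H -> H) y : bounded_operator A ->
  exists z, forall x, dot (A x) y = dot x z.
Proof.
move=> /bounded_operatorP[linA [C C0 bA]].
pose a f : R[i] := (dot (A f) y)^*.
have lin_combo (B : {fset H}) : dot (A (\sum_(f <- B) a f *: f)) y =
    (\sum_(f <- B) sqmod (a f))%:C.
  rewrite (lin_sum linA) dot_suml rmorph_sum; apply: eq_bigr => f _ /=.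
  by rewrite (linZ linA) dotZl -mulJc conjcK.
have fin : (\esum_(f in F) (sqmod (a f))%:E < +oo)%E.
  apply: (@le_lt_trans _ _ (C * sqnorm y)%:E); last exact: ltry.
  apply: esum_le_fset => B BF; set s := \sum_(f <- B) _.
  have s0 : 0 <= s by apply: sumr_ge0 => f _; exact: sqmod_ge0.
  pose w : H := \sum_(f <- B) a f *: f.
  have hw : sqnorm w = s by exact: sqnorm_combo ortF _ _ BF.
  have := cauchy_schwarz (A w) y; rewrite lin_combo -/s sqmod_real => h.
  have {h} : s ^+ 2 <= s * (C * sqnorm y).
    apply: le_trans h _; rewrite mulrA [s * C]mulrC -hw.
    by rewrite ler_wpM2r// sqnorm_ge0.
  move: s0; rewrite le_eqVlt => /predU1P[<- _|s0].
    by rewrite mulr_ge0 ?sqnorm_ge0.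
  by rewrite expr2 ler_pM2l.
have [z [za _]] := riesz_fischer ortF fin.
exists z => x; apply/eqP; rewrite -subr_eq0; apply/eqP/sqmod_eq0/eqP.
rewrite eq_le sqmod_ge0 andbT; apply/ler_addgt0Pr => e e0; rewrite add0r.
(* Both sides agree on w; the squared modulus of their difference at x - w is at
   most |x - w|^2 K. *)
pose K := 2 * (C * sqnorm y + sqnorm z) + 1.
have K0 : 0 < K by rewrite ltr_wpDl// mulr_ge0// addr_ge0 ?mulr_ge0 ?sqnorm_ge0.
have [B BF xB] := basis_dense basF x (divr_gt0 e0 K0).
set w := \sum_(f <- B) _ in xB.
have wz : dot (A w) y = dot w z.
  rewrite (lin_sum linA) !dot_suml big_seq [RHS]big_seq.
  apply: eq_bigr => f fB; rewrite (linZ linA) !dotZl; congr (_ * _).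
  by rewrite (dotC f z) za ?conjcK//; exact: BF.
have -> : dot (A x) y - dot x z = dot (A (x - w)) y + - dot (x - w) z.
  by rewrite (linB linA) !dotBl wz; ring.
apply: le_trans (sqmodD_le _ _) _.
have h1 : sqmod (dot (A (x - w)) y) <= C * sqnorm (x - w) * sqnorm y.
  by apply: le_trans (cauchy_schwarz _ _) _; rewrite ler_wpM2r ?sqnorm_ge0.
have h2 : sqmod (- dot (x - w) z) <= sqnorm (x - w) * sqnorm z.
  by rewrite -dotNr -(sqnormN z); exact: cauchy_schwarz.
have h3 : sqnorm (x - w) * K <= e by rewrite -ler_pdivlMr// ltW.
move: h3; rewrite /K; have := sqnorm_ge0 (x - w).
move: h1 h2; set P := sqnorm (x - w); move: (sqnorm y) (sqnorm z) => Y Z; nra.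
Qed.

Lemma adjoint_exists (A : H -> H) : bounded_operator A ->
  exists B : H -> H, bounded_operator B /\
    forall x y, dot (A x) y = dot x (B y).
Proof.
move=> bA; have [B AB] := choice (fun y => adjoint_vector y bA).
exists B; split=> //; apply/bounded_operatorP; split.
  move=> a u v; apply: dot_ext => z; rewrite dotC -AB dotDr dotZr.
  by rewrite dotDl dotZl rmorphD rmorphM/= conjcK !AB -!dotC.
move: bA => /bounded_operatorP[linA [C C0 bA]]; exists C => // y.
have [->|By0] := eqVneq (B y) 0; first by rewrite sqnorm0 mulr_ge0 ?sqnorm_ge0.
have := cauchy_schwarz (A (B y)) y.
rewrite AB dot_sqnorm sqmod_real => h.
rewrite -(ler_pM2l (sqnorm_gt0 By0)) -expr2; apply: le_trans h _.
by rewrite mulrA [_ * C]mulrC ler_wpM2r ?sqnorm_ge0.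
Qed.

Lemma diagonal_exists (s : H -> R) (C : R) : 0 <= C ->
  (forall f, F f -> s f ^+ 2 <= C) ->
  exists T : H -> H, bounded_operator T /\
    forall v f, F f -> dot (T v) f = (s f)%:C * dot v f.
Proof.
move=> C0 sC.
have sumC v : (\esum_(f in F) (sqmod ((s f)%:C * dot v f))%:E <=
    (C * sqnorm v)%:E)%E.
  rewrite EFinM -(parseval basF) -esumZl//; last first.
    by move=> f _; rewrite lee_fin sqmod_ge0.
  apply: le_esum => f Ff; rewrite sqmodM sqmod_real -EFinM lee_fin.
  by rewrite ler_wpM2r ?sqmod_ge0 ?sC.
have /choice[T TE] v : exists x, forall f, F f -> dot x f = (s f)%:C * dot v f.
  have fin := le_lt_trans (sumC v) (ltry _).
  by have [x [xE _]] := riesz_fischer ortF fin; exists x.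
exists T; split=> //; apply/bounded_operatorP; split.
  move=> a u v; apply: (basis_ext basF) => f Ff.
  by rewrite dotDl dotZl !TE// dotDl dotZl; ring.
exists C => // v; rewrite -lee_fin -(parseval basF); apply: le_trans (sumC v).
by apply: le_esum => f Ff; rewrite TE.
Qed.

Lemma diagonal_eigen (T : H -> H) (s : H -> R) :
  (forall v f, F f -> dot (T v) f = (s f)%:C * dot v f) ->
  forall f, F f -> T f = (s f)%:C *: f.
Proof.
move=> TE f Ff; apply: (basis_ext basF) => g Fg; rewrite TE// dotZl.
have [->//|/eqP fg] := eqVneq f g.
by rewrite (ortF.2 f g)// !mulr0.
Qed.

(** Knowing S on F determines its coefficients on all vectors, because the adjoint
    of S is diagonal with the same eigenvalues. *)
Lemma eigen_diagonal (S : H -> H) (m : H -> R) : bounded_operator S ->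
  (forall f, F f -> S f = (m f)%:C *: f) ->
  forall v f, F f -> dot (S v) f = (m f)%:C * dot v f.
Proof.
move=> bS SE v f Ff; have [B [_ SB]] := adjoint_exists bS.
have Bf : B f = (m f)%:C *: f.
  apply: (basis_ext basF) => g Fg; rewrite dotC -SB SE// !dotZl conjcM conjc_real.
  rewrite -dotC; have [->//|/eqP fg] := eqVneq f g.
  by rewrite (ortF.2 f g)// !mulr0.
by rewrite SB Bf dotZr conjc_real.
Qed.

(** With T the square root of S, <S v, v> = |T v|^2, and Parseval's identity applies
    to T v. *)
Lemma diagonal_form (S : H -> H) (m : H -> R) (C : R) :
  0 <= C -> (forall f, F f -> 0 <= m f <= C) ->
  (forall v f, F f -> dot (S v) f = (m f)%:C * dot v f) ->
  forall v, 0 <= dot (S v) v /\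
    (complex.Re (dot (S v) v))%:E =
      \esum_(f in F) (m f * sqmod (dot v f))%:E.
Proof.
move=> C0 mC SE v.
have [f Ff|T [bT TE]] := @diagonal_exists (fun f => Num.sqrt (m f)) C C0.
  by have /andP[m0 ?] := mC f Ff; rewrite sqr_sqrtr.
have [B [_ TB]] := adjoint_exists bT.
have BT : B (T v) = S v.
  apply: (basis_ext basF) => f Ff; rewrite SE// dotC -TB -dotC.
  rewrite (diagonal_eigen TE Ff) dotZr conjc_real TE// mulrA -rmorphM/=.
  by rewrite -expr2 sqr_sqrtr//; have /andP[] := mC f Ff.
have dotS : dot (S v) v = (sqnorm (T v))%:C.
  by rewrite dotC -BT -TB dot_sqnorm conjc_real.
rewrite dotS ler0c sqnorm_ge0; split=> //=; rewrite -(parseval basF).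
apply: eq_esum => f Ff; rewrite TE// sqmodM sqmod_real sqr_sqrtr//.
by have /andP[] := mC f Ff.
Qed.

End FixedBasis.

(** Polarization over the complex numbers: the sesquilinear form
    <T x, y> - <x, T y> vanishes on the diagonal, as <T x, x> is real. *)
Lemma positive_selfadjoint (T : H -> H) : positive_operator dot T ->
  forall x y, dot (T x) y = dot x (T y).
Proof.
move=> [/bounded_operatorP[linT _] posT].
pose b x y := dot (T x) y - dot x (T y).
have bxx x : b x x = 0.
  rewrite /b (dotC x (T x)); have := posT x; case: (dot _ _) => u w.
  by rewrite lecE/= => /andP[/eqP-> _]; rewrite oppr0 subrr.
have bD x y : b x y + b y x = 0.
  have := bxx (x + y); rewrite /b (linD linT) !dotDl !dotDr.
  have := bxx x; have := bxx y; rewrite /b.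
  move: (dot (T x) x) (dot x (T x)) (dot (T y) y) (dot y (T y)) => p q r s.
  move=> /subr0_eq-> /subr0_eq-> h; rewrite -[RHS]h; ring.
move=> x y; apply/eqP; rewrite -subr_eq0 -/(b x y).
have ci : ('i%C : R[i])^*%C = - 'i%C by simpc.
have := bD ('i%C *: x) y; rewrite /b (linZ linT) !dotZl !dotZr ci.
have := bD x y; rewrite /b => h1 h2.
have : 2 * 'i%C * b x y = 0.
  (* The left side is the second relation plus i times the first one. *)
  rewrite /b -[RHS]h2 -[X in X = _]addr0 -[X in _ + X = _](mulr0 (- 'i%C)).
  by rewrite -[X in - 'i%C * X]h1; ring.
move=> /eqP; rewrite !mulf_eq0 pnatr_eq0/= => /orP[|//].
by rewrite eq_complex/= oner_eq0 andbF.
Qed.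

(** * Compact operators and their eigenbases *)

Implicit Types A B : H -> H.
Local Notation unit_ball := [set x : H | `|x| <= 1].

Lemma compact_subset_precompact (S K : set H) :
  compact K -> S `<=` K -> precompact S.
Proof.
move=> cK SK; apply: (precompact_subset SK).
by apply: compact_precompact => //; exact: norm_hausdorff.
Qed.

Lemma bounded_comp A B : bounded_operator A -> bounded_operator B ->
  bounded_operator (A \o B).
Proof.
move=> [linA cA] [linB cB]; split.
  by move=> a u v /=; rewrite linB linA.
by move=> x; apply: continuous_comp; [exact: cB|exact: cA].
Qed.

Lemma boundedD A B : bounded_operator A -> bounded_operator B ->
  bounded_operator (fun x => A x + B x).
Proof.
move=> [linA cA] [linB cB]; split.
  by move=> a u v /=; rewrite linB linA scalerDr addrACA.
by move=> x; apply: cvgD; [exact: cA|exact: cB].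
Qed.

Lemma compact_operator_comp A B : bounded_operator B -> compact_operator A ->
  compact_operator (B \o A).
Proof.
move=> bB [bA cA]; split; first exact: bounded_comp.
apply: (@compact_subset_precompact _ (B @` closure (A @` unit_ball))).
  apply: continuous_compact; last by rewrite -precompactE.
  by apply: continuous_subspaceT; case: bB.
by move=> _ [x x1 <-]; exists (A x) => //; apply: subset_closure; exists x.
Qed.

Lemma compact_operatorD A B : compact_operator A -> compact_operator B ->
  compact_operator (fun x => A x + B x).
Proof.
move=> [bA cA] [bB cB]; split; first exact: boundedD.
apply: (@compact_subset_precompact _ ((fun z : H * H => z.1 + z.2) @`
    (closure (A @` unit_ball) `*` closure (B @` unit_ball)))).
  apply: continuous_compact; last first.
    by apply: compact_setX; rewrite -precompactE.
  by apply: continuous_subspaceT => z; exact: add_continuous.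
move=> _ [x x1 <-]; exists (A x, B x) => //=.
by split; apply: subset_closure; exists x.
Qed.

Lemma compact_operatorZ (a : R[i]) A : compact_operator A ->
  compact_operator (fun x => a *: A x).
Proof.
apply: compact_operator_comp; split.
  by move=> b u v; rewrite scalerDr scalerA mulrC -scalerA.
by move=> x; exact: scaler_continuous.
Qed.

Lemma compact_operator0 : compact_operator (fun=> 0 : H).
Proof.
split; first split.
- by move=> a u v; rewrite scaler0 addr0.
- by move=> x; exact: cvg_cst.
apply: (@compact_subset_precompact _ [set 0]); first exact: compact_set1.
by move=> _ [x _ <-].
Qed.

Lemma compact_operator_sum (I : finType) (A : I -> H -> H) :
  (forall i, compact_operator (A i)) ->
  compact_operator (fun x => \sum_i A i x).
Proof.
move=> cA; elim: (index_enum I) => [|i r IH].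
  have -> : (fun x => \sum_(i <- [::]) A i x) = (fun=> 0).
    by apply/funext => x; rewrite big_nil.
  exact: compact_operator0.
have -> : (fun x => \sum_(j <- i :: r) A j x) =
          (fun x => A i x + \sum_(j <- r) A j x).
  by apply/funext => x; rewrite big_cons.
exact: compact_operatorD.
Qed.

Lemma norm_le1_sqnorm x : (`|x| <= 1) = (sqnorm x <= 1).
Proof.
rewrite -(@ler_pXn2r _ 2%N)// ?nnegrE ?ler01// norm_sqnorm expr1n.
by rewrite -[1]/(1%:C) lecR.
Qed.

Lemma sqnorm_continuous : continuous (sqnorm : H -> R).
Proof.
move=> x; apply/cvgrPdist_lt => e e0.
pose K := 1 + 2 * sqnorm x / e.
have K0 : 0 < K by rewrite ltr_pwDl// divr_ge0 ?mulr_ge0 ?sqnorm_ge0// ltW.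
apply/nbhs_sqnorm; exists (e / 2 / K); first by rewrite !divr_gt0.
move=> y; rewrite ltr_pdivlMr// => hxy.
set z := x - y in hxy; have yE : y = x - z by rewrite /z subKr.
rewrite /= yE sqnormB; set t := complex.Re (dot x z).
have -> : sqnorm x - (sqnorm x + sqnorm z - 2 * t) = 2 * t - sqnorm z by ring.
have ht : t ^+ 2 <= sqnorm x * sqnorm z.
  exact: le_trans (Re_sqr_le _) (cauchy_schwarz _ _).
have hz := sqnorm_ge0 z.
have e2 : 0 < 2 / e by rewrite divr_gt0.
have ht' : 2 / e * t ^+ 2 <= 2 * sqnorm x / e * sqnorm z.
  by rewrite [leRHS](_ : _ = 2 / e * (sqnorm x * sqnorm z)) ?ler_pM2l//; ring.
have sq1 : 0 <= 2 / e * (t - e / 2) ^+ 2 by rewrite mulr_ge0 ?sqr_ge0// ltW.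
have sq2 : 0 <= 2 / e * (t + e / 2) ^+ 2 by rewrite mulr_ge0 ?sqr_ge0// ltW.
have E1 : 2 / e * (t - e / 2) ^+ 2 = 2 / e * t ^+ 2 - 2 * t + e / 2.
  by field; rewrite gt_eqF.
have E2 : 2 / e * (t + e / 2) ^+ 2 = 2 / e * t ^+ 2 + 2 * t + e / 2.
  by field; rewrite gt_eqF.
move: hxy; rewrite /K mulrDr mulr1 [sqnorm z * _]mulrC => hxy.
rewrite E1 in sq1; rewrite E2 in sq2.
rewrite ltr_norml; apply/andP; split; lra.
Qed.

Lemma closure_sqnorm (S : set H) x (e : R) : closure S x -> 0 < e ->
  exists2 v, S v & sqnorm (x - v) < e.
Proof.
move=> Sx e0; have [v [Sv xv]] : S `&` [set v | sqnorm (x - v) < e] !=set0.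
  by apply: Sx; apply/nbhs_sqnorm; exists e.
by exists v.
Qed.

Section Spectral.
Variable X : H -> H.
Hypothesis posX : positive_operator dot X.
Hypothesis cptX : precompact (X @` unit_ball).

Let bX : bounded_operator X. Proof. by case: posX. Qed.
Let linX : linear X. Proof. by case: bX. Qed.
Let saX := positive_selfadjoint posX.

(** As <f, f> = 1, the eigenvalue of f can only be <X f, f>. *)
Definition eigenset (F : set H) : Prop := orthonormal_set F /\
  forall f, F f -> X f = (complex.Re (dot (X f) f))%:C *: f.

(** On the orthogonal complement of F, which X preserves, let M be the maximum of
    |y|^2 over the closure of the image of its unit ball, attained at y; so M is
    the squared norm of X there.  If M = 0, then X x = 0.  Otherwise Cauchy-Schwarz
    gives
      |X^2 w - M w|^2 <= M |w|^2 (M - |w|^2)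
    for w in the image, hence on its closure, hence X^2 y = M y.  With r^2 = M,
    either X y + r y is an eigenvector for r, or it is zero and y is one
    for - r. *)
Lemma eigenvector_orthogonal (F : set H) x : eigenset F -> x != 0 ->
  (forall f, F f -> dot x f = 0) ->
  exists2 z, z != 0 & (forall f, F f -> dot z f = 0) /\
    exists r : R, X z = r%:C *: z.
Proof.
move=> [ortF eigF] x0 xF.
pose perp v := forall f, F f -> dot v f = 0.
have perpX v : perp v -> perp (X v).
  by move=> vF f Ff; rewrite saX eigF// dotZr vF// mulr0.
have perpZ a v : perp v -> perp (a *: v).
  by move=> vF f Ff; rewrite dotZl vF// mulr0.
have perpD u v : perp u -> perp v -> perp (u + v).
  by move=> uF vF f Ff; rewrite dotDl uF// vF// addr0.
pose S := X @` [set v | sqnorm v <= 1 /\ perp v].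
have SK : closure S `<=` closure (X @` unit_ball).
  apply: closure_subset => _ [v [v1 _] <-]; exists v => //=.
  by rewrite norm_le1_sqnorm.
have cK : compact (closure S).
  by apply: subclosed_compact SK; [exact: closed_closure|rewrite -precompactE].
have perpK y : closure S y -> perp y.
  move=> Sy f Ff; apply: (dot_eq_closure ortF Ff) => e e0.
  have [_ [v [_ vF] <-] yv] := closure_sqnorm Sy e0.
  by exists (X v) => //; exact: perpX.
have S0 : closure S !=set0.
  exists 0; apply: subset_closure; exists 0; last exact: lin0.
  by split=> [|f Ff]; rewrite /= ?sqnorm0 ?ler01 ?dot0l.
have [y /set_mem Ky maxy] := compact_EVT_max S0 cK
  (continuous_subspaceT sqnorm_continuous).
set M := sqnorm y in maxy.
have bound v : perp v -> sqnorm (X v) <= M * sqnorm v.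
  move=> vF; have [->|v0] := eqVneq v 0.
    by rewrite (lin0 linX) sqnorm0 mulr0.
  have hv := sqnorm_gt0 v0.
  pose a : R[i] := (Num.sqrt (sqnorm v)^-1)%:C.
  have ha : sqmod a = (sqnorm v)^-1 by rewrite sqmod_real sqr_sqrtr// invr_ge0 ltW.
  have : sqnorm (X (a *: v)) <= M.
    apply: maxy; apply: mem_set; apply: subset_closure; exists (a *: v) => //.
    by split; [rewrite sqnormZ ha mulVf// gt_eqF|exact: perpZ].
  by rewrite (linZ linX) sqnormZ ha ler_pdivrMl// mulrC.
have [M0|M0] := eqVneq M 0.
  exists x => //; split=> //; exists 0; rewrite scale0r.
  apply: sqnorm_eq0; apply/eqP; rewrite eq_le sqnorm_ge0 andbT.
  by have := bound x xF; rewrite M0 mul0r.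
have Mgt0 : 0 < M by rewrite lt_def M0 sqnorm_ge0.
have y0 : y != 0 by apply: contra_neq M0 => yz; rewrite /M yz sqnorm0.
pose D v := X (X v) - M%:C *: v.
(* For w = X u with |u| <= 1: |w|^4 = <u, X w>^2 <= |X w|^2. *)
have key v : S v -> sqnorm (D v) - M * sqnorm v * (M - sqnorm v) <= 0.
  move=> [u [u1 uF] <-]; set w := X u.
  have wF : perp w by exact: perpX.
  rewrite /D sqnormB sqnormZ dotZr conjc_real Re_realM sqmod_real.
  rewrite (saX (X w) w).
  have : sqnorm (X (X w)) <= M * sqnorm (X w) by exact/bound/perpX.
  have : sqnorm w ^+ 2 <= sqnorm (X w).
    have := cauchy_schwarz u (X w); rewrite -saX -/w dot_sqnorm sqmod_real.
    by move/le_trans; apply; rewrite ler_piMl ?sqnorm_ge0.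
  rewrite -/(sqnorm (X w)); move: (sqnorm (X (X w))) (sqnorm (X w)) (sqnorm w) => a b c.
  move=> h1 h2; nra.
have contD : continuous D.
  have [_ cX] := bX; move=> v; apply: cvgB; last exact: scaler_continuous.
  by apply: (continuous_comp (cX v)); exact: cX.
have contg : continuous (fun v => sqnorm (D v) - M * sqnorm v * (M - sqnorm v)).
  move=> v; apply: cvgB.
    by apply: (continuous_comp (contD v)); exact: sqnorm_continuous.
  apply: cvgM; first by apply: cvgM; [exact: cvg_cst|exact: sqnorm_continuous].
  by apply: cvgB; [exact: cvg_cst|exact: sqnorm_continuous].
have keyK : sqnorm (D y) - M * sqnorm y * (M - sqnorm y) <= 0.
  have cl : closed [set v | sqnorm (D v) - M * sqnorm v * (M - sqnorm v) <= 0].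
    exact: (closed_comp (fun v _ => contg v) (@closed_le _ 0)).
  have : closure [set v | sqnorm (D v) - M * sqnorm v * (M - sqnorm v) <= 0] y.
    exact: closure_subset key _ Ky.
  by rewrite -(closure_id _).1.
have Dy : X (X y) = M%:C *: y.
  apply/eqP; rewrite -subr_eq0; apply/eqP/sqnorm_eq0/eqP.
  rewrite eq_le sqnorm_ge0 andbT; apply: le_trans keyK.
  by rewrite -/M subrr mulr0 subr0.
pose r := Num.sqrt M.
have rr : r%:C * r%:C = M%:C :> R[i].
  by rewrite -rmorphM/= -expr2 sqr_sqrtr// ltW.
have yF := perpK y Ky.
have [z0|z0] := eqVneq (X y + r%:C *: y) 0.
  exists y => //; split=> //; exists (- r).
  by apply/eqP; rewrite -subr_eq0 rmorphN scaleNr opprK z0.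
exists (X y + r%:C *: y) => //; split.
  by apply: perpD; [exact: perpX|exact: perpZ].
exists r; rewrite (linD linX) (linZ linX) Dy scalerDr scalerA rr addrC.
by [].
Qed.

(** A maximal orthonormal set of eigenvectors is a basis: otherwise the lemma above
    would provide a further eigenvector orthogonal to it. *)
Theorem spectral_basis : exists2 F, orthonormal_basis dot F & eigenset F.
Proof.
have [G GE tot|F [eigF maxF]] := @Zorn_bigcup H eigenset.
  have chain e f : (\bigcup_(F in G) F) e -> (\bigcup_(F in G) F) f ->
      exists2 F, G F & F e /\ F f.
    move=> [F1 GF1 F1e] [F2 GF2 F2f].
    by have [s|s] := tot _ _ GF1 GF2; [exists F2|exists F1] => //;
      split=> //; exact: s.
  split; first split.
  - by move=> e [F /GE[[un _] _]]; exact: un.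
  - move=> e f Ge Gf; have [F GF [Fe Ff]] := chain e f Ge Gf.
    by case: (GE _ GF) => -[_ or] _; exact: or.
  - by move=> f [F /GE[_ eig]]; exact: eig.
exists F => //; case: (eigF) => -[un or] eig; split=> // x xF.
apply: contrapT => /eqP x0.
have [z z0 [zF [r zr]]] := eigenvector_orthogonal eigF x0 xF.
have hz := sqnorm_gt0 z0.
pose a : R[i] := (Num.sqrt (sqnorm z)^-1)%:C; pose e := a *: z.
have ee : dot e e = 1.
  rewrite dot_sqnorm /e sqnormZ sqmod_real sqr_sqrtr ?invr_ge0 ?sqnorm_ge0//.
  by rewrite mulVf ?gt_eqF.
have eF f : F f -> dot e f = 0 by move=> Ff; rewrite dotZl zF// mulr0.
have Xe : X e = r%:C *: e.
  by rewrite /e (linZ linX) zr !scalerA mulrC.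
apply: (maxF (F `|` [set e])).
  split; first exact: subsetUl.
  move=> /(_ e (or_intror erefl)) /eF; rewrite ee => /eqP.
  by rewrite oner_eq0.
split; first split.
- by move=> f [/un//|->].
- move=> f g [Ff|->] [Fg|->] fg; first exact: or.
  + by rewrite dotC eF// conjc0.
  + exact: eF.
  + by [].
move=> f [/eig//|->]; by rewrite Xe dotZl ee mulr1.
Qed.

End Spectral.

(** All vectors are eigenvectors of the zero operator. *)
Lemma basis_exists : exists F, orthonormal_basis dot F.
Proof.
have [[l0 c0] p0] := compact_operator0.
have pos : positive_operator dot (fun=> 0) by split=> // x; rewrite dot0l.
by have [F basF _] := spectral_basis pos p0; exists F.
Qed.

(** * Sums of diagonalized quadratic forms *)

Definition diagonalizes (Q : H -> R) (F : set H) (m : H -> R) : Prop :=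
  [/\ orthonormal_basis dot F, forall f, F f -> 0 <= m f &
      forall v, \esum_(f in F) (m f * sqmod (dot v f))%:E = (Q v)%:E].

Lemma sqmod_dotC x y : sqmod (dot x y) = sqmod (dot y x).
Proof. by rewrite dotC sqmodJ. Qed.

Lemma basis_sqnorm F f : orthonormal_basis dot F -> F f -> sqnorm f = 1.
Proof. by case=> un _ _ Ff; rewrite /sqnorm un. Qed.

Section Diagonalization.
Variables (Q : H -> R) (F : set H) (m : H -> R).
Hypothesis QF : diagonalizes Q F m.

Lemma diagonalizes_term v f : F f -> m f * sqmod (dot v f) <= Q v.
Proof.
case: QF => _ m0 QE Ff; rewrite -lee_fin -QE.
apply: (esum_ge_term (a := fun f => (m f * sqmod (dot v f))%:E)) => // g Fg.
by rewrite lee_fin mulr_ge0 ?m0 ?sqmod_ge0.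
Qed.

Lemma diagonalizes_basis f : F f -> Q f = m f.
Proof.
case: QF => basF m0 QE Ff; apply/EFin_inj; rewrite -QE.
have ff : dot f f = 1 by case: basF => un _ _; exact: un.
rewrite (@esum_support _ _ _ _ [fset f]%fset).
- by rewrite big_seq_fset1 ff sqmod_real expr1n mulr1.
- by move=> g Fg; rewrite mulr_ge0 ?m0 ?sqmod_ge0.
- by move=> g /=; rewrite inE => /eqP->.
move=> g Fg; rewrite inE => /eqP gf; case: basF => _ or _.
by rewrite or// ?sqmod0 ?mulr0//; exact/nesym.
Qed.

End Diagonalization.

Section Sums.
Variables (I : finType) (Q : I -> H -> R) (G : I -> set H) (m : I -> H -> R).
Variables (F : set H) (l : H -> R).
Hypothesis QG : forall i, diagonalizes (Q i) (G i) (m i).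
Hypothesis QF : diagonalizes (fun v => \sum_i Q i v) F l.

Let basF : orthonormal_basis dot F. Proof. by case: QF. Qed.
Let l0 f : F f -> 0 <= l f. Proof. by case: QF => _ + _; apply. Qed.
Let basG i : orthonormal_basis dot (G i). Proof. by case: (QG i). Qed.
Let m0 i f : G i f -> 0 <= m i f. Proof. by case: (QG i) => _ + _; apply. Qed.

Let Qge0 i v : 0 <= Q i v.
Proof.
case: (QG i) => _ _ QE; rewrite -lee_fin -QE esum_ge0// => f Gf.
by rewrite lee_fin mulr_ge0 ?m0 ?sqmod_ge0.
Qed.

Let Q_le_sum i v : Q i v <= \sum_j Q j v.
Proof. by rewrite (bigD1 i)//= lerDl sumr_ge0. Qed.

Let S := [set: I] `*`` G.

Let weight_term i h f : G i h -> F f -> l f = 0 ->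
  m i h * sqmod (dot h f) = 0.
Proof.
move=> Gh Ff lf; apply/eqP; rewrite eq_le mulr_ge0 ?m0 ?sqmod_ge0// andbT.
rewrite sqmod_dotC; apply: le_trans (diagonalizes_term (QG i) f Gh) _.
by rewrite -lf -(diagonalizes_basis QF Ff) Q_le_sum.
Qed.

(** This is m <h, X^-1 h> <= 1, with X the operator of the form sum_j Q_j.  With
    s the sum of the |<h, f>|^2 / l f over a finite subset and v the
    corresponding part of X^-1 h, one has <h, v> = s = <X v, v>, while
    m |<h, v>|^2 <= Q_i v <= <X v, v>; thus m s^2 <= s. *)
Let weight_row i h : G i h ->
  (\esum_(f in F) (m i h * sqmod (dot h f) / l f)%:E <= 1)%E.
Proof.
move=> Gh; apply: esum_le_fset => B BF.
set s := \sum_(f <- B) sqmod (dot h f) / l f.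
have -> : \sum_(f <- B) m i h * sqmod (dot h f) / l f = m i h * s.
  by rewrite mulr_sumr; apply: eq_bigr => f _; rewrite mulrA.
have mh := m0 Gh.
have s0 : 0 <= s.
  rewrite /s big_seq sumr_ge0// => f /BF Ff.
  by rewrite divr_ge0 ?sqmod_ge0 ?l0.
pose a f : R[i] := ((l f)^-1)%:C * dot h f.
pose v : H := \sum_(f <- B) a f *: f.
have ortF := basis_orthonormal basF.
have Qv : \sum_j Q j v = s.
  case: QF => _ _ QE; apply/EFin_inj; rewrite -QE.
  rewrite (@esum_support _ _ _ _ B)//.
  - rewrite /s big_seq [in RHS]big_seq; congr _%:E.
    apply: eq_bigr => f fB.
    rewrite (dot_combo ortF)// ?fB ?sqmodM ?sqmod_real; last exact: BF.
    have [->|lf] := eqVneq (l f) 0; first by rewrite invr0 mulr0 mul0r.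
    by field.
  - by move=> f Ff; rewrite mulr_ge0 ?l0 ?sqmod_ge0.
  - by move=> f Ff /negbTE fB; rewrite (dot_combo ortF)// fB sqmod0 mulr0.
have hv : dot h v = s%:C.
  rewrite dot_comboE /s rmorph_sum; apply: eq_bigr => f _ /=.
  by rewrite /a conjcM conjc_real -mulrA [_^*%C * _]mulrC mulJc -rmorphM/= mulrC.
have := le_trans (diagonalizes_term (QG i) v Gh) (Q_le_sum i v).
rewrite sqmod_dotC hv sqmod_real Qv => h1.
move: s0; rewrite le_eqVlt => /predU1P[<-|s0]; first by rewrite mulr0.
by rewrite -(ler_pM2r s0) mul1r -mulrA -expr2.
Qed.

Let weight_col f : F f -> l f != 0 ->
  \esum_(k in S) (m k.1 k.2 * sqmod (dot k.2 f) / l f)%:E = 1%:E.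
Proof.
move=> Ff lf.
rewrite (@esum_sigma _ _ _ G (fun i h => (m i h * sqmod (dot h f) / l f)%:E)).
  rewrite (eq_bigr (fun i => (Q i f / l f)%:E)); last first.
    move=> i _; case: (QG i) => _ _ QE.
    rewrite mulrC EFinM -QE -esumZl ?invr_ge0 ?l0//; last first.
      by move=> h Gh; rewrite lee_fin mulr_ge0 ?m0 ?sqmod_ge0.
    apply: eq_esum => h Gh; rewrite -EFinM sqmod_dotC; congr _%:E; ring.
  by rewrite sumEFin -mulr_suml (diagonalizes_basis QF Ff) divff.
by move=> i h Gh; rewrite lee_fin divr_ge0 ?l0// mulr_ge0 ?m0 ?sqmod_ge0.
Qed.

(** Where l f = 0, the form Q_i vanishes at f, so that m |<h, f>|^2 = 0 and the
    junk value of the division is harmless. *)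
Let pinch_sum k : S k ->
  \esum_(f in F) (m k.1 k.2 * sqmod (dot k.2 f) / l f * l f)%:E =
  (m k.1 k.2)%:E.
Proof.
case: k => i h [_ /= Gh].
rewrite (eq_esum (b := fun f => (m i h)%:E * (sqmod (dot h f))%:E)%E).
  rewrite esumZl ?m0// ?(parseval basF) ?(basis_sqnorm (basG i))// ?mule1//.
  by move=> f _; rewrite lee_fin sqmod_ge0.
move=> f Ff; rewrite -EFinM; have [lf|lf] := eqVneq (l f) 0.
  by rewrite lf mulr0 (weight_term Gh).
by rewrite divfK.
Qed.

(** Superadditivity of X |-> tr X^q for q >= 1 (McCarthy), and subadditivity for
    q <= 1. *)
Lemma trace_sum_ge1 (q : R) : 1 <= q ->
  (\sum_i \esum_(h in G i) (m i h `^ q)%:E <= \esum_(f in F) (l f `^ q)%:E)%E.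
Proof.
move=> q1; rewrite -esum_sigma; last by move=> *; rewrite lee_fin powR_ge0.
rewrite -[leRHS]mul1e.
apply: (@majorization_ge1 R _ _ S F
  (fun k f => m k.1 k.2 * sqmod (dot k.2 f) / l f) (fun k => m k.1 k.2) l 1) => //.
- by move=> [i h] f [_ Gh] Ff; rewrite divr_ge0 ?l0// mulr_ge0 ?m0 ?sqmod_ge0.
- by move=> [i h] [_ Gh]; exact: m0.
- by move=> [i h] [_ Gh]; exact: weight_row.
Qed.

Lemma trace_sum_le1 (q : R) : 0 < q -> q <= 1 ->
  (\esum_(f in F) (l f `^ q)%:E <= \sum_i \esum_(h in G i) (m i h `^ q)%:E)%E.
Proof.
move=> q0 q1; rewrite -esum_sigma; last by move=> *; rewrite lee_fin powR_ge0.
rewrite -[leLHS]mul1e.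
apply: (@majorization_le1 R _ _ S F
  (fun k f => m k.1 k.2 * sqmod (dot k.2 f) / l f) (fun k => m k.1 k.2) l 1) => //.
- by move=> [i h] f [_ Gh] Ff; rewrite divr_ge0 ?l0// mulr_ge0 ?m0 ?sqmod_ge0.
- by move=> [i h] [_ Gh]; exact: m0.
- by move=> [i h] [_ Gh]; exact: weight_row.
Qed.

(** The weights |<f, h>|^2 / n spread the eigenvalue l f over the eigenvalues
    n m_ih: the rows add up to 1 and the columns to 1 / n, by Parseval's identity. *)
Hypothesis I0 : (0 < #|I|)%N.
Let n : R := #|I|%:R.
Let n0 : 0 < n. Proof. by rewrite ltr0n. Qed.

Let mean_sum f : F f ->
  \esum_(k in S) (sqmod (dot f k.2) / n * (n * m k.1 k.2))%:E = (l f)%:E.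
Proof.
move=> Ff.
rewrite (@esum_sigma _ _ _ G (fun i h => (sqmod (dot f h) / n * (n * m i h))%:E)).
  rewrite -(diagonalizes_basis QF Ff) -sumEFin; apply: eq_bigr => i _.
  case: (QG i) => _ _ <-; apply: eq_esum => h _; congr _%:E.
  by field; rewrite gt_eqF.
move=> i h Gh; rewrite lee_fin mulr_ge0 ?divr_ge0 ?mulr_ge0 ?m0 ?sqmod_ge0//;
  exact: ltW.
Qed.

Let mean_row f : F f -> (\esum_(k in S) (sqmod (dot f k.2) / n)%:E <= 1)%E.
Proof.
move=> Ff; rewrite (@esum_sigma _ _ _ G (fun i h => (sqmod (dot f h) / n)%:E)).
  rewrite (eq_bigr (fun=> (n^-1)%:E)); last first.
    move=> i _; rewrite (eq_esum (b := fun h => (n^-1)%:E * (sqmod (dot f h))%:E)%E).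
      rewrite esumZl ?(parseval (basG i)) ?(basis_sqnorm basF)// ?mule1 ?invr_ge0 ?(ltW n0)//.
      by move=> h _; rewrite lee_fin sqmod_ge0.
    by move=> h _; rewrite -EFinM mulrC.
  rewrite sumEFin sumr_const -mulr_natr mulVf// gt_eqF//.
by move=> i h _; rewrite lee_fin divr_ge0 ?sqmod_ge0// ltW.
Qed.

Let mean_col k : S k ->
  \esum_(f in F) (sqmod (dot f k.2) / n)%:E = (n^-1)%:E.
Proof.
case: k => i h [_ /= Gh].
rewrite (eq_esum (b := fun f => (n^-1)%:E * (sqmod (dot h f))%:E)%E).
  rewrite esumZl ?(parseval basF) ?(basis_sqnorm (basG i))// ?mule1 ?invr_ge0 ?(ltW n0)//.
  by move=> f _; rewrite lee_fin sqmod_ge0.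
by move=> f _; rewrite -EFinM mulrC sqmod_dotC.
Qed.

Let scaled_sum (q : R) : 0 < q ->
  ((n^-1)%:E * (\esum_(k in S) ((n * m k.1 k.2) `^ q)%:E) =
   (n `^ (q - 1))%:E * \sum_i \esum_(h in G i) (m i h `^ q)%:E)%E.
Proof.
move=> q0; rewrite -esum_sigma; last by move=> *; rewrite lee_fin powR_ge0.
have -> : (\esum_(k in S) ((n * m k.1 k.2) `^ q)%:E =
    (n `^ q)%:E * (\esum_(k in S) (m k.1 k.2 `^ q)%:E))%E.
  rewrite -esumZl ?powR_ge0//; last by move=> k _; rewrite lee_fin powR_ge0.
  apply: eq_esum => -[i h] [_ /= Gh]; rewrite powRM ?m0//; exact: ltW.
rewrite muleA -EFinM; congr (_%:E * _)%E.
by rewrite -(mulr_powRB1 (ltW n0) q0) mulrA mulVf ?gt_eqF// mul1r.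
Qed.

(** Convexity of X |-> tr X^q for q >= 1, and concavity for q <= 1. *)
Lemma trace_mean_ge1 (q : R) : 1 <= q ->
  (\esum_(f in F) (l f `^ q)%:E <=
   (n `^ (q - 1))%:E * \sum_i \esum_(h in G i) (m i h `^ q)%:E)%E.
Proof.
move=> q1; rewrite -scaled_sum ?(lt_le_trans ltr01)//.
apply: (@majorization_ge1 R _ _ F S (fun f k => sqmod (dot f k.2) / n) l
  (fun k => n * m k.1 k.2) n^-1) => //.
- by move=> f [i h] Ff _; rewrite divr_ge0 ?sqmod_ge0// ltW.
- by rewrite invr_ge0 ltW.
- by move=> [i h] [_ Gh]; rewrite mulr_ge0 ?m0// ltW.
- by move=> k Sk _; exact: mean_col.
Qed.

Lemma trace_mean_le1 (q : R) : 0 < q -> q <= 1 ->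
  ((n `^ (q - 1))%:E * (\sum_i \esum_(h in G i) (m i h `^ q)%:E) <=
   \esum_(f in F) (l f `^ q)%:E)%E.
Proof.
move=> q0 q1; rewrite -scaled_sum//.
apply: (@majorization_le1 R _ _ F S (fun f k => sqmod (dot f k.2) / n) l
  (fun k => n * m k.1 k.2) n^-1) => //.
- by move=> f [i h] Ff _; rewrite divr_ge0 ?sqmod_ge0// ltW.
- by rewrite invr_ge0 ltW.
- by move=> [i h] [_ Gh]; rewrite mulr_ge0 ?m0// ltW.
- by move=> k Sk _; exact: mean_col.
Qed.

End Sums.

(** * Schatten norms through eigenvalues *)

Lemma adjointP (A : H -> H) : bounded_operator A ->
  bounded_operator (adjoint dot A) /\
  forall x y, dot (A x) y = dot x (adjoint dot A y).
Proof.
move=> bA; have [F basF] := basis_exists.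
exact: (getPex (adjoint_exists basF bA)).
Qed.

Lemma gram_form (A : H -> H) x : bounded_operator A ->
  dot (adjoint dot A (A x)) x = (sqnorm (A x))%:C.
Proof. by move=> /adjointP[_ AE]; rewrite dotC -AE dot_sqnorm conjc_real. Qed.

Lemma gram_compact (A : H -> H) : compact_operator A ->
  compact_operator (adjoint dot A \o A).
Proof.
move=> cA; apply: compact_operator_comp => //.
by case: cA => /adjointP[].
Qed.

Lemma eigenvalues_bounded (S : H -> H) F (m : H -> R) :
  bounded_operator S -> orthonormal_basis dot F ->
  (forall f, F f -> S f = (m f)%:C *: f) -> (forall f, F f -> 0 <= m f) ->
  exists2 C : R, 0 <= C & forall f, F f -> 0 <= m f <= C.
Proof.
move=> /bounded_operatorP[_ [C C0 bS]] basF Sm m0.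
(* The bound on S gives m f ^ 2 <= C, hence m f <= C + 1. *)
exists (C + 1); first by rewrite addr_ge0.
move=> f Ff; rewrite m0//= leNgt; apply/negP => lt.
have := bS f; rewrite Sm// sqnormZ sqmod_real (basis_sqnorm basF Ff) !mulr1.
have := m0 f Ff; nra.
Qed.

Section PositiveCompact.
Variables (X : H -> H).
Hypotheses (posX : positive_operator dot X) (cptX : compact_operator X).

Lemma positive_compact_diagonalizes : exists F, exists2 m : H -> R,
  diagonalizes (fun v => complex.Re (dot (X v) v)) F m &
  forall f, F f -> X f = (m f)%:C *: f.
Proof.
have [F basF [_ eig]] := spectral_basis posX cptX.2.
pose m f := complex.Re (dot (X f) f); exists F, m => //.
have m0 f : F f -> 0 <= m f.
  by move=> _; have := posX.2 f; rewrite lecE => /andP[].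
have [C C0 mC] := eigenvalues_bounded posX.1 basF eig m0.
split=> // v; have XE := eigen_diagonal basF posX.1 eig.
by have [_ ->] := diagonal_form basF C0 mC XE v.
Qed.

End PositiveCompact.

Lemma square_sum_diagonalizes (I : finType) (A : I -> H -> H) :
  (forall i, compact_operator (A i)) ->
  exists F, exists m : H -> R, diagonalizes (fun v => \sum_i sqnorm (A i v)) F m.
Proof.
move=> cA; pose X v := \sum_i adjoint dot (A i) (A i v).
have cX : compact_operator X.
  by apply: compact_operator_sum => i; exact: gram_compact.
have XE v : dot (X v) v = (\sum_i sqnorm (A i v))%:C.
  rewrite dot_suml rmorph_sum; apply: eq_bigr => i _ /=.
  by rewrite gram_form//; case: (cA i).
have posX : positive_operator dot X.
  split; first by case: cX.
  by move=> v; rewrite XE ler0c sumr_ge0// => i _; exact: sqnorm_ge0.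
have [F [m [basF m0 QE] _]] := positive_compact_diagonalizes posX cX.
by exists F, m; split=> // v; rewrite QE XE.
Qed.

Lemma sqrt_exists (X : H -> H) : positive_operator dot X ->
  compact_operator X ->
  exists T : H -> H, positive_operator dot T /\ T \o T = X.
Proof.
move=> posX cX.
have [F [m [basF m0 _] Xm]] := positive_compact_diagonalizes posX cX.
have [C C0 mC] := eigenvalues_bounded posX.1 basF Xm m0.
have sC f : F f -> Num.sqrt (m f) ^+ 2 <= C.
  by move=> Ff; have /andP[m0f ?] := mC f Ff; rewrite sqr_sqrtr.
have [T [bT TE]] := diagonal_exists basF C0 sC.
have sC' f : F f -> 0 <= Num.sqrt (m f) <= Num.sqrt C.
  by move=> Ff; have /andP[m0f ?] := mC f Ff; rewrite sqrtr_ge0 ler_wsqrtr.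
exists T; split.
  by split=> // v; have [] := diagonal_form basF (sqrtr_ge0 C) sC' TE v.
apply/funext => v /=; apply: (basis_ext basF) => f Ff.
rewrite !TE// (eigen_diagonal basF posX.1 Xm)// mulrA -rmorphM/= -expr2.
by rewrite sqr_sqrtr// m0.
Qed.

(** A positive square root of X is diagonal in any eigenbasis of X, so whichever
    root defines |A| is known there.  The vector z = T f - sqrt r f satisfies
    T z = - sqrt r z, which positivity of T only allows for z = 0 if r > 0; if r = 0,
    then |T f|^2 = <T^2 f, f> = 0. *)
Lemma sqrt_eigenvector (T : H -> H) f (r : R) : positive_operator dot T ->
  0 <= r -> T (T f) = r%:C *: f -> T f = (Num.sqrt r)%:C *: f.
Proof.
move=> posT r0 TTf; have saT := positive_selfadjoint posT.
case: (posT) => -[linT _] pos.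
apply/eqP; rewrite -subr_eq0; apply/eqP.
move: r0; rewrite le_eqVlt => /predU1P[rz|r0].
  rewrite -rz sqrtr0 scale0r subr0; apply: sqnorm_eq0.
  by rewrite /sqnorm saT TTf -rz scale0r dot0r.
set z := T f - _.
have Tz : T z = - (Num.sqrt r)%:C *: z.
  rewrite /z (linB linT) (linZ linT) TTf scalerBr scalerA mulNr -rmorphM/=.
  by rewrite -expr2 sqr_sqrtr ?(ltW r0)// !scaleNr opprK addrC.
apply: sqnorm_eq0; apply/eqP; rewrite eq_le sqnorm_ge0 andbT.
have := pos z; rewrite Tz dotZl dot_sqnorm -rmorphN -rmorphM/= ler0c mulNr.
by rewrite oppr_ge0 pmulr_rle0 ?sqrtr_gt0.
Qed.

Section Power.
Variables (T : H -> H) (F : set H) (s : H -> R) (p : R).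
Hypotheses (bT : bounded_operator T) (basF : orthonormal_basis dot F).
Hypotheses (p0 : 0 < p) (s0 : forall f, F f -> 0 <= s f).
Hypothesis Ts : forall f, F f -> T f = (s f)%:C *: f.

(** The operator with eigenvalues s f ^ p on F acts as r ^ p on every eigenvector
    for r, since such a vector has nonzero coefficients only where s f = r. *)
Lemma power_operator_eigen : bounded_operator (power_operator T p) /\
  forall f, F f -> power_operator T p f = (s f `^ p)%:C *: f.
Proof.
have [C C0 sC] := eigenvalues_bounded bT basF Ts s0.
have spC f : F f -> (s f `^ p) ^+ 2 <= (C `^ p) ^+ 2.
  move=> Ff; rewrite ler_pXn2r// ?nnegrE ?powR_ge0//.
  have /andP[sf0 sfC] := sC f Ff.
  by apply: ge0_ler_powR; rewrite ?nnegrE ?(ltW p0).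
have ex : exists S : H -> H, bounded_operator S /\ forall (r : R) (x : H),
    T x = r%:C *: x -> S x = (r `^ p)%:C *: x.
  have [S [bS SE]] := diagonal_exists basF (sqr_ge0 _) spC.
  exists S; split=> // r x Tx; apply: (basis_ext basF) => f Ff.
  rewrite SE// dotZl.
  have := eigen_diagonal basF bT Ts x Ff; rewrite Tx dotZl => /eqP.
  rewrite -subr_eq0 -mulrBl mulf_eq0 subr_eq0 => /orP[/eqP/complexI->//|/eqP->].
  by rewrite !mulr0.
have [bS SE] := getPex ex.
by split=> // f Ff; apply: SE; exact: Ts.
Qed.

(** The trace is computed in another basis E; since
    <S e, e> = sum_f s_f^p |<e, f>|^2, exchanging the sums and Parseval's identity
    in E give |f|^2 = 1 for the coefficient of s_f^p. *)
Lemma trace_power : trace dot (power_operator T p) =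
  \esum_(f in F) (s f `^ p)%:E.
Proof.
have [bS SE] := power_operator_eigen; rewrite /trace.
have basE : orthonormal_basis dot (get (orthonormal_basis dot)).
  exact: (getPex basis_exists).
set E := get _ in basE *.
have [C C0 sC] := eigenvalues_bounded bS basF SE (fun f _ => powR_ge0 (s f) p).
have Sd := eigen_diagonal basF bS SE.
rewrite (eq_esum (b := fun e => \esum_(f in F)
    (s f `^ p * sqmod (dot e f))%:E)); last first.
  by move=> e _; have [_ ->] := diagonal_form basF C0 sC Sd e.
rewrite esum_exchange; last first.
  by move=> e f _ _; rewrite lee_fin mulr_ge0 ?powR_ge0 ?sqmod_ge0.
apply: eq_esum => f Ff.
rewrite (eq_esum (b := fun e => (s f `^ p)%:E * (sqmod (dot f e))%:E)%E).
  rewrite esumZl ?powR_ge0// ?(parseval basE) ?(basis_sqnorm basF Ff) ?mule1//.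
  by move=> e _; rewrite lee_fin sqmod_ge0.
by move=> e _; rewrite -EFinM sqmod_dotC.
Qed.

End Power.

(** |A| has the eigenvalues sqrt (m f) and |A|^p the eigenvalues m f ^ (p / 2). *)
Lemma schatten_diagonalizes (A : H -> H) (p : R) : compact_operator A -> 0 < p ->
  exists F, exists2 m : H -> R, diagonalizes (fun v => sqnorm (A v)) F m &
    (schatten_norm dot p A `^ p = \esum_(f in F) (m f `^ (p / 2))%:E)%E.
Proof.
move=> cA p0; have bA := cA.1.
pose X := adjoint dot A \o A.
have cX : compact_operator X by exact: gram_compact.
have posX : positive_operator dot X.
  by split=> [|v]; [case: cX|rewrite gram_form// ler0c sqnorm_ge0].
have [F [m [basF m0 QE] Xm]] := positive_compact_diagonalizes posX cX.
exists F, m; first by split=> // v; rewrite QE /X /= gram_form.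
have [posT TT] : positive_operator dot (abs_operator dot A) /\
    abs_operator dot A \o abs_operator dot A = X.
  exact: (getPex (sqrt_exists posX cX)).
have Tm f : F f -> abs_operator dot A f = (Num.sqrt (m f))%:C *: f.
  move=> Ff; apply: sqrt_eigenvector => //; first exact: m0.
  by rewrite -Xm// -TT.
rewrite /schatten_norm -poweRrM mulVf ?gt_eqF//.
rewrite (trace_power posT.1 basF p0 _ Tm); last by move=> f _; exact: sqrtr_ge0.
rewrite poweRe1; last by apply: esum_ge0 => f _; rewrite lee_fin powR_ge0.
apply: eq_esum => f Ff.
by rewrite -powR12_sqrt ?m0// -powRrM mulrC.
Qed.

(** The comparisons of the sum of the |A_i|_p^p with the trace of (sum_i A_i^*A_i)^(p/2),
    whose eigenvalues are the l f ^ (p / 2). *)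
Section SchattenSums.
Variables (I : finType) (A : I -> H -> H) (F : set H) (l : H -> R) (p : R).
Hypotheses (cA : forall i, compact_operator (A i)) (p0 : 0 < p).
Hypothesis QF : diagonalizes (fun v => \sum_i sqnorm (A i v)) F l.

Let half0 : 0 < p / 2. Proof. by rewrite divr_gt0. Qed.

Let diag : exists G, exists2 m : I -> H -> R,
  forall i, diagonalizes (fun v => sqnorm (A i v)) (G i) (m i) &
  (\sum_i schatten_norm dot p (A i) `^ p =
    \sum_i \esum_(h in G i) (m i h `^ (p / 2))%:E)%E.
Proof.
have /choice[Gm GmE] i : exists Gm : set H * (H -> R),
    diagonalizes (fun v => sqnorm (A i v)) Gm.1 Gm.2 /\
    (schatten_norm dot p (A i) `^ p =
      \esum_(f in Gm.1) (Gm.2 f `^ (p / 2))%:E)%E.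
  by have [G [m Gd Gs]] := schatten_diagonalizes (cA i) p0; exists (G, m).
exists (fun i => (Gm i).1), (fun i => (Gm i).2); first by move=> i; case: (GmE i).
by apply: eq_bigr => i _; case: (GmE i).
Qed.

Lemma schatten_le_trace_sum : 2 <= p ->
  (\sum_i schatten_norm dot p (A i) `^ p <=
    \esum_(f in F) (l f `^ (p / 2))%:E)%E.
Proof.
move=> p2; have [G [m Gd ->]] := diag.
by apply: (trace_sum_ge1 Gd QF); rewrite ler_pdivlMr// mul1r.
Qed.

Lemma trace_sum_le_schatten : p <= 2 ->
  (\esum_(f in F) (l f `^ (p / 2))%:E <=
    \sum_i schatten_norm dot p (A i) `^ p)%E.
Proof.
move=> p2; have [G [m Gd ->]] := diag.
by apply: (trace_sum_le1 Gd QF) => //; rewrite ler_pdivrMr// mul1r.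
Qed.

Lemma trace_sum_le_mean : (0 < #|I|)%N -> 2 <= p ->
  (\esum_(f in F) (l f `^ (p / 2))%:E <=
    (#|I|%:R `^ (p / 2 - 1))%:E * \sum_i schatten_norm dot p (A i) `^ p)%E.
Proof.
move=> I0 p2; have [G [m Gd ->]] := diag.
by apply: (trace_mean_ge1 Gd QF) => //; rewrite ler_pdivlMr// mul1r.
Qed.

Lemma mean_le_trace_sum : (0 < #|I|)%N -> p <= 2 ->
  ((#|I|%:R `^ (p / 2 - 1))%:E * (\sum_i schatten_norm dot p (A i) `^ p) <=
    \esum_(f in F) (l f `^ (p / 2))%:E)%E.
Proof.
move=> I0 p2; have [G [m Gd ->]] := diag.
by apply: (trace_mean_le1 Gd QF) => //; rewrite ler_pdivrMr// mul1r.
Qed.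

End SchattenSums.

(** * Deviations from the mean *)

(** The identity between the variance and the second moment. *)
Lemma sum_sqnorm_deviation n (a : 'I_n -> H) : (0 < n)%N ->
  let m := n%:R^-1 *: \sum_j a j in
  \sum_i sqnorm (a i - m) + n%:R * sqnorm m = \sum_i sqnorm (a i).
Proof.
move=> n0 m.
have sumE : \sum_j a j = n%:R *: m.
  by rewrite /m scalerA mulfV ?scale1r// pnatr_eq0 -lt0n.
rewrite (eq_bigr (fun i => sqnorm (a i) + sqnorm m - 2 * complex.Re (dot (a i) m))).
  rewrite sumrB big_split/= sumr_const card_ord -mulr_sumr.
  rewrite -(Re_sum (index_enum 'I_n) (fun i => dot (a i) m)) -dot_suml.
  have nC : n%:R = (n%:R : R)%:C :> R[i] by rewrite rmorph_nat.
  rewrite sumE nC dotZl dot_sqnorm Re_realM/= -mulr_natl; ring.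
by move=> i _; rewrite sqnormB.
Qed.

End HilbertSpace.

(** The difference in the statement is taken in the extended reals.  Finiteness of
    the norms of the A_i makes its first term finite; in part (i) the second term
    may a priori be infinite, and then the difference is - oo, while in part (ii)
    the comparison itself bounds it. *)
Theorem theorem2p10 (R : realType) (H : completeNormedModType R[i])
    (dot : {dot H for conjC}) (dot_norm : hilbert_norm dot)
    (sepH : separable H) (p : R) (p_gt0 : 0 < p)
    (n : nat) (n_gt0 : (0 < n)%N) (A : 'I_n -> H -> H)
    (A_Cp : forall i, schatten_class dot p (A i)) :
  let M : H -> H := n%:R^-1 *: \sum_(j < n) A j in
  (p < 2 ->
    (\sum_(i < n) schatten_norm dot p (A i - M)%R `^ p >=
     (n%:R `^ (p / 2 - 1))%:E * \sum_(i < n) schatten_norm dot p (A i) `^ p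
     - n%:R%:E * schatten_norm dot p M `^ p)%E) /\
  (2 < p ->
    ((n%:R `^ (p / 2 - 1))%:E * \sum_(i < n) schatten_norm dot p (A i) `^ p
     - n%:R%:E * schatten_norm dot p M `^ p >=
     \sum_(i < n) schatten_norm dot p (A i - M)%R `^ p)%E).
Proof.
move=> M.
have ME x : M x = n%:R^-1 *: \sum_j A j x.
  by rewrite /M /GRing.scale/= fct_sumE.
have cA i : compact_operator (A i) by case: (A_Cp i).
have cM : compact_operator M.
  have -> : M = fun x => n%:R^-1 *: \sum_j A j x by apply/funext.
  exact: compact_operatorZ (compact_operator_sum cA).
have cD i : compact_operator (A i - M)%R.
  have -> : (A i - M)%R = fun x => A i x + (-1) *: M x.
    by apply/funext => x; rewrite scaleN1r.
  exact: compact_operatorD (cA i) (compact_operatorZ _ cM).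
(* The family of the deviations followed by n copies of the mean. *)
pose B (k : 'I_n + 'I_n) : H -> H :=
  match k with inl i => (A i - M)%R | inr _ => M end.
have cB k : compact_operator (B k) by case: k => i; [exact: cD|exact: cM].
have [F [l QA]] := square_sum_diagonalizes dot_norm cA.
have QB : diagonalizes dot (fun v => \sum_k sqnorm dot (B k v)) F l.
  case: QA => basF l0 QE; split=> // v; rewrite QE; congr _%:E.
  rewrite big_sumType/= sumr_const card_ord -mulr_natl.
  rewrite -(sum_sqnorm_deviation dot (fun i => A i v) n_gt0) -ME.
  by [].
have sumB : (\sum_k schatten_norm dot p (B k) `^ p =
    \sum_(i < n) schatten_norm dot p (A i - M)%R `^ p +
    n%:R%:E * schatten_norm dot p M `^ p)%E.
  by rewrite big_sumType/= sumr_const card_ord mule_natl.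
have card0 : (0 < #|'I_n|)%N by rewrite card_ord.
have fin_mean : ((n%:R `^ (p / 2 - 1))%:E *
    \sum_(i < n) schatten_norm dot p (A i) `^ p)%E \is a fin_num.
  rewrite fin_numM//; apply/sum_fin_numP => i _ _.
  rewrite ge0_fin_numE ?poweR_ge0//.
  by apply: poweR_lty; case: (A_Cp i).
split=> p2.
  have := mean_le_trace_sum dot_norm cA p_gt0 QA card0 (ltW p2).
  move=> /le_trans /(_ (trace_sum_le_schatten dot_norm cB p_gt0 QB (ltW p2))).
  rewrite sumB card_ord; move: fin_mean.
  set a := (_ * _)%E; set d := (\sum_(i < n) _)%E; set b := (_ * _)%E.
  have : (0 <= b)%E by rewrite mule_ge0// ?poweR_ge0 ?lee_fin.
  case: (b) => [r| |]// _ fina adb; first by rewrite leeBlDr.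
  by rewrite -(fineK fina)/= leNye.
have := schatten_le_trace_sum dot_norm cB p_gt0 QB (ltW p2).
move=> /le_trans /(_ (trace_sum_le_mean dot_norm cA p_gt0 QA card0 (ltW p2))).
rewrite sumB card_ord; move: fin_mean.
set a := (_ * _)%E; set d := (\sum_(i < n) _)%E; set b := (_ * _)%E => fina dba.
have b0 : (0 <= b)%E by rewrite mule_ge0// ?poweR_ge0 ?lee_fin.
have d0 : (0 <= d)%E by apply: sume_ge0 => i _; exact: poweR_ge0.
have finb : b \is a fin_num.
  rewrite ge0_fin_numE//; apply: (@le_lt_trans _ _ a); last by rewrite ltey_eq fina.
  by apply: le_trans dba; rewrite leeDr.
by rewrite leeBrDr.
Qed.
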